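(* Let $N$ be a smooth manifold and consider the Lagrangian $L(x,v)=Q_x(v)+\mu_x(v)-U(x)$, $(x,v)\in TN$, where $Q$ is a positive definite $C^{2}$ quadratic form on $TN$, $\mu$ is a $C^{2}$ differential one-form on $N$, and $U:N\to\mathbb{R}$ is a nonnegative $C^{2}$ function. Let $\rho$ be the Riemannian metric on $N$ with $Q_x(v)=\Vert v\Vert_x^{2}/2$. Let $p\in N$ with $U(p)=0$, and suppose there are a neighborhood $V$ of $p$ in $N$ and a real valued $C^{3}$ regular function $f$ on $V$ such that $$dU(\nabla_\rho f)=O(U)\qquad\text{and}\qquad \Vert\,\iota_{\nabla_\rho f}\,d\mu\,\Vert_{TN^{*}}=O(U^{1/2})$$ on $V$. Then $(p,\mathbf{0})\in TN$ is a Lyapunov unstable equilibrium point of the Lagrangian dynamics (Euler-Lagrange flow on $TN$) of $L$.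
   Context: $\nabla_\rho f$ is the gradient of $f$ with respect to $\rho$; $\iota_X$ is the interior product (contraction) with the vector field $X$; $\Vert\cdot\Vert_{TN^{*}}$ is the norm on cotangent spaces dual to the norm of $\rho$. A function is regular on $V$ if its differential is nonzero at every point of $V$. For nonnegative $w$, $h=O(w)$ on $V$ means there is a constant $K>0$ with $|h(x)|\le K\,w(x)$ for all $x\in V$. An equilibrium point $(p,\mathbf{0})$ is Lyapunov stable if for every neighborhood $\mathcal{O}$ of it in $TN$ there is a neighborhood $\mathcal{O}'$ of it such that every solution $(x(t),\dot x(t))$ of the Euler-Lagrange equations with $(x(0),\dot x(0))\in\mathcal{O}'$ is defined and stays in $\mathcal{O}$ for all $t\ge 0$; it is Lyapunov unstable if it is not Lyapunov stable. *)

(* Defs.v *)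
From HB Require Import structures.
From mathcomp Require Import all_boot all_order all_algebra.
From mathcomp Require Import all_classical all_reals all_analysis.

Set Implicit Arguments.
Unset Strict Implicit.
Unset Printing Implicit Defensive.

Import Order.TTheory GRing.Theory Num.Theory numFieldNormedType.Exports.

Local Open Scope classical_set_scope.
Local Open Scope ring_scope.

(* Meant for A open: f is C^(k+1) when it is (Frechet) differentiable and all
   the maps x |-> df_x(v) are C^k; in finite dimension this is the usual
   notion. *)
Fixpoint Ck (R : realType) (V W : normedModType R) (k : nat) (A : set V)
    (f : V -> W) : Prop :=
  match k with
  | 0 => forall x, A x -> {for x, continuous f}
  | k'.+1 => (forall x, A x -> differentiable f x) /\
             (forall v, Ck k' A (fun x => 'd f x v))
  end.

(* A smooth n-manifold without boundary, presented by a smooth atlas.  The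
   atlas need not be maximal: all the notions below depend only on the smooth
   structure that it generates.  [chart i] and [chart_inv i] are total
   functions, meaningful only on [chart_dom i] and on its image. *)
Record smoothManifold (R : realType) (n : nat) := SmoothManifold {
  carrier :> topologicalType;
  carrier_hausdorff : hausdorff_space carrier;
  carrier_second_countable : @second_countable carrier;
  chart_index : Type;
  chart_dom : chart_index -> set carrier;
  chart : chart_index -> carrier -> 'rV[R]_n;
  chart_inv : chart_index -> 'rV[R]_n -> carrier;
  chart_at : carrier -> chart_index;
  chart_atP : forall x, chart_dom (chart_at x) x;
  chart_dom_open : forall i, open (chart_dom i);
  chart_image_open : forall i, open (chart i @` chart_dom i);
  chartK : forall i x, chart_dom i x -> chart_inv i (chart i x) = x;
  chart_continuous : forall i x, chart_dom i x -> {for x, continuous (chart i)};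
  chart_inv_continuous : forall i x, chart_dom i x ->
    {for chart i x, continuous (chart_inv i)};
  transition_smooth : forall i j k,
    Ck k (chart i @` (chart_dom i `&` chart_dom j)) (chart j \o chart_inv i)
}.

Section TangentSpace.
Context {R : realType} {n : nat} (M : smoothManifold R n).
Local Notation I := (chart_index M).

Definition transition_diff (i j : I) (x : M) : 'rV[R]_n -> 'rV[R]_n :=
  'd (chart j \o chart_inv i) (chart i x).

(* A tangent vector at x is the family of its coordinate vectors in all the
   charts around x, related by the differentials of the transition maps.  The
   irrelevant entries (charts that do not contain x) are set to 0. *)
Definition tangent_family (x : M) (v : I -> 'rV[R]_n) : Prop :=
  (forall i j, chart_dom i x -> chart_dom j x ->
     v j = transition_diff i j x (v i)) /\
  (forall i, ~ chart_dom i x -> v i = 0).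

Definition tangent_pred (x : M) : {pred I -> 'rV[R]_n} :=
  fun v => `[< tangent_family x v >].

Lemma tangent_submod_closed (x : M) : submod_closed (tangent_pred x).
Proof.
split=> [|a u v /asboolP[uP u0] /asboolP[vP v0]]; apply/asboolP; split.
- by move=> i j _ _; rewrite /transition_diff linear0.
- by [].
- move=> i j xi xj; rewrite /transition_diff.
  by rewrite !fctE (uP i j) // (vP i j) // linearP.
- by move=> i xi; rewrite !fctE u0 // v0 // scaler0 addr0.
Qed.

HB.instance Definition _ (x : M) :=
  GRing.isSubmodClosed.Build R (I -> 'rV[R]_n) (tangent_pred x)
    (tangent_submod_closed x).

Record tangent (x : M) := Tangent {
  tcoord :> I -> 'rV[R]_n;
  _ : tcoord \in tangent_pred x
}.

HB.instance Definition _ (x : M) := [isSub for @tcoord x].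
HB.instance Definition _ (x : M) := [Choice of tangent x by <:].
HB.instance Definition _ (x : M) :=
  [SubChoice_isSubLmodule of tangent x by <:].

(* The vector at x with coordinates u in the chart i (0 if i does not contain
   x). *)
Definition tvec_fun (i : I) (x : M) (u : 'rV[R]_n) (j : I) : 'rV[R]_n :=
  if `[< chart_dom i x /\ chart_dom j x >] then transition_diff i j x u else 0.

Lemma transition_differentiable (i j : I) (x : M) :
  chart_dom i x -> chart_dom j x ->
  differentiable (chart j \o chart_inv i) (chart i x).
Proof.
move=> xi xj; have [+ _] := transition_smooth i j 1.
by apply; exists x.
Qed.

Lemma transition_diff_comp (i j k : I) (x : M) (u : 'rV[R]_n) :
  chart_dom i x -> chart_dom j x -> chart_dom k x ->
  transition_diff i k x u = transition_diff j k x (transition_diff i j x u).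
Proof.
move=> xi xj xk.
have dij := transition_differentiable xi xj.
have dik := transition_differentiable xi xk.
have Ejx : (chart j \o chart_inv i) (chart i x) = chart j x.
  by rewrite /= chartK.
have djk : differentiable (chart k \o chart_inv j)
    ((chart j \o chart_inv i) (chart i x)).
  by rewrite Ejx; exact: transition_differentiable.
have dc := differentiable_comp dij djk.
have Hc := congr1 (@^~ u) (diff_comp dij djk).
rewrite Ejx in Hc; apply: eq_trans Hc; rewrite /transition_diff.
apply: (eq_trans (esym (deriveE u dik))).
apply: (eq_trans _ (deriveE u dc)).
apply: near_eq_derive.
have : nbhs (chart i x) (chart_inv i @^-1` chart_dom j).
  apply: (chart_inv_continuous xi); rewrite chartK //.
  by apply: open_nbhs_nbhs; split => //; exact: chart_dom_open.
by apply: filterS => z /= zj; rewrite chartK.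
Qed.

Lemma tvec_subproof (i : I) (x : M) (u : 'rV[R]_n) :
  tvec_fun i x u \in tangent_pred x.
Proof.
apply/asboolP; split=> [j k xj xk|j xj]; rewrite /tvec_fun.
- case: asboolP => [[xi _]|Nik]; case: asboolP => [[xi' _]|Nij].
  + exact: transition_diff_comp.
  + by case: Nij.
  + by case: Nik.
  + by rewrite /transition_diff linear0.
- by case: asboolP => // -[].
Qed.

Definition tvec (i : I) (x : M) (u : 'rV[R]_n) : tangent x :=
  Tangent (tvec_subproof i x u).

End TangentSpace.

Section Tensors.
Context {R : realType} {n : nat} (M : smoothManifold R n).

(* Meant for A open. *)
Definition Ck_fun (k : nat) (A : set M) (g : M -> R) : Prop :=
  forall i, Ck k (chart i @` (chart_dom i `&` A)) (g \o chart_inv i).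

(* Coordinate expression, in the chart i, of a function on the tangent
   bundle. *)
Definition local_rep (F : forall x : M, tangent x -> R) (i : chart_index M)
    (xi u : 'rV[R]_n) : R :=
  F (chart_inv i xi) (tvec i (chart_inv i xi) u).

(* Regularity of a field of linear or quadratic forms: its values on constant
   coordinate vectors are C^k, i.e. its coefficients in every chart are C^k
   (by linearity or polarization). *)
Definition Ck_form (k : nat) (F : forall x : M, tangent x -> R) : Prop :=
  forall i u, Ck k (chart i @` chart_dom i) (fun xi => local_rep F i xi u).

Definition one_form (mu : forall x : M, tangent x -> R) : Prop :=
  forall x, scalar (mu x).

Definition inner_product (E : lmodType R) (b : E -> E -> R) : Prop :=
  [/\ forall v, scalar (b v), forall v w, b v w = b w v
    & forall v, v != 0 -> 0 < b v v].

Definition quadratic_form (E : lmodType R) (q : E -> R) : Prop :=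
  exists2 b : E -> E -> R,
    (forall v, scalar (b v)) /\ (forall v w, b v w = b w v)
    & forall v, q v = b v v.

(* dg_x(v), computed in a chart around x. *)
Definition dfun (g : M -> R) (x : M) (v : tangent x) : R :=
  let i := chart_at x in 'd (g \o chart_inv i) (chart i x) (v i).

Definition regular_on (V : set M) (g : M -> R) : Prop :=
  forall x, V x -> exists v : tangent x, dfun g v != 0.

(* dmu_x(v, w) = v(mu(w)) - w(mu(v)), where v and w are extended around x with
   constant coordinates in a chart around x. *)
Definition dform (mu : forall x : M, tangent x -> R) (x : M)
    (v w : tangent x) : R :=
  let i := chart_at x in
  'd (fun xi => local_rep mu i xi (w i)) (chart i x) (v i) -
  'd (fun xi => local_rep mu i xi (v i)) (chart i x) (w i).

(* Pointwise condition only: a metric with Q_x(v) = |v|_x^2 / 2 inherits the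
   C^2 regularity of Q by polarization. *)
Definition riemannian_metric (rho : forall x : M, tangent x -> tangent x -> R)
  : Prop := forall x, inner_product (rho x).

Definition tnorm (rho : forall x : M, tangent x -> tangent x -> R) (x : M)
  (v : tangent x) : R := Num.sqrt (rho x v v).

(* The unique vector g at x such that rho_x(g, w) = df_x(w) for all w. *)
Definition gradient (rho : forall x : M, tangent x -> tangent x -> R)
    (f : M -> R) (x : M) : tangent x :=
  xget 0 [set g | forall w, rho x g w = dfun f w].

Definition conorm (rho : forall x : M, tangent x -> tangent x -> R) (x : M)
    (alpha : tangent x -> R) : R :=
  sup [set `|alpha v| | v in [set v | tnorm rho v <= 1]].

Definition big_O_on (V : set M) (h w : M -> R) : Prop :=
  exists2 K : R, 0 < K & forall x, V x -> `|h x| <= K * w x.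

End Tensors.

Section Dynamics.
Context {R : realType} {n : nat} (M : smoothManifold R n).

Definition tangent_bundle := {x : M & tangent x}.

Definition tb_point (x : M) (v : tangent x) : tangent_bundle :=
  existT (@tangent R n M) x v.

(* Neighborhoods in TM, through the induced chart (x, v) |-> (chart i x, v i)
   of TM. *)
Definition tb_nbhs (z : tangent_bundle) : set_system tangent_bundle :=
  [set O | let i := chart_at (tag z) in
    nbhs (chart i (tag z), tagged z i)
      [set y | O (tb_point (tvec i (chart_inv i y.1) y.2))]].

Definition Ck_curve (k : nat) (J : set R) (g : R -> M) : Prop :=
  (forall t, J t -> {for t, continuous g}) /\
  forall i, Ck k (J `&` g @^-1` chart_dom i) (chart i \o g).

Definition velocity (g : R -> M) (t : R) : tangent (g t) :=
  let i := chart_at (g t) in tvec i (g t) ('D_1 (chart i \o g) t).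

Definition phase (g : R -> M) (t : R) : tangent_bundle :=
  tb_point (velocity g t).

(* In every chart: d/ds (dL/dv . e)(c(s), c'(s)) = (dL/dx . e)(c(s), c'(s)) at
   s = t for every coordinate vector e, where c is the local expression of g;
   this includes the existence of the derivative on the left. *)
Definition euler_lagrange_at (L : forall x : M, tangent x -> R) (g : R -> M)
    (t : R) : Prop :=
  forall i, chart_dom i (g t) -> forall e : 'rV[R]_n,
    let c := chart i \o g in
    is_derive t (1 : R)
      (fun s => 'D_e (fun u => local_rep L i (c s) u) ('D_1 c s))
      ('D_e (fun xi => local_rep L i xi ('D_1 c t)) (c t)).

(* g is a solution on J, an open interval containing the initial time 0; its
   values outside J are irrelevant. *)
Definition solution (L : forall x : M, tangent x -> R) (J : set R)
    (g : R -> M) : Prop :=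
  [/\ is_interval J, open J, J 0, Ck_curve 2 J g
    & forall t, J t -> euler_lagrange_at L g t].

Definition maximal_solution (L : forall x : M, tangent x -> R) (J : set R)
    (g : R -> M) : Prop :=
  solution L J g /\
  forall J' g', solution L J' g' -> J `<=` J' -> (forall t, J t -> g' t = g t) -> J' `<=` J.

(* (p, 0) is an equilibrium point of the Euler-Lagrange dynamics. *)
Definition equilibrium (L : forall x : M, tangent x -> R) (p : M) : Prop :=
  solution L setT (cst p).

Definition lyapunov_stable (L : forall x : M, tangent x -> R) (p : M) : Prop :=
  forall O, tb_nbhs (tb_point (0 : tangent p)) O ->
  exists2 O', tb_nbhs (tb_point (0 : tangent p)) O' &
    forall J g, maximal_solution L J g -> O' (phase g 0) ->
      forall t, 0 <= t -> J t /\ O (phase g t).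

Definition lyapunov_unstable_equilibrium (L : forall x : M, tangent x -> R)
  (p : M) : Prop := equilibrium L p /\ ~ lyapunov_stable L p.

End Dynamics.

(* Main.v *)
Require Import Defs.
From HB Require Import structures.
From mathcomp Require Import all_boot all_order all_algebra.
From mathcomp Require Import all_classical all_reals all_analysis.
From mathcomp Require Import ring lra.

(** Along a solution x(t) the energy E = Q(x') + U is conserved, and the
    derivative of phi = df(x') is Hess f(x', x') + dmu(grad f, x') - dU(grad f).
    Near p each of the three terms is bounded by a constant multiple of E:
    the first because |x'|^2 <= 2 E, the other two by the hypotheses on U and
    mu.  A solution starting at p with velocity e * u0, df(u0) > 0, has energy
    of order e^2 and phi(0) of order e, so phi stays above phi(0) / 2 during a
    time of order 1 / e.  Meanwhile f increases by an amount that does not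
    depend on e, hence the solution leaves a fixed neighborhood of p.

    Stability quantifies over maximal solutions, so such a solution must be
    shown to exist: Picard iteration in a chart, invariance of the
    Euler-Lagrange equations under changes of charts, and Zorn's lemma. *)

Set Implicit Arguments.
Unset Strict Implicit.
Unset Printing Implicit Defensive.

Import Order.TTheory GRing.Theory Num.Theory numFieldNormedType.Exports.

Local Open Scope classical_set_scope.
Local Open Scope ring_scope.

(** The exponents in the hypotheses make every term of the derivative of phi quadratic in the pair
    (|v|, sqrt U), like the energy; the magnetic term is controlled by sqrt U |v|, a geometric mean
    of the two parts of E. With [alpha = df(u0)], [beta = Q(u0)] and [D] the resulting constant, the
    derivative is at most [D e^2 beta], so phi keeps half of [e alpha] up to time
    [alpha / (2 D beta e)] and f gains [alpha^2 / (4 D beta)]. This gain is known before [e] is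
    chosen, which allows the neighborhood to be fixed first. It constrains positions only, since E
    controls velocities, and the stability to be refuted keeps the solution in one chart for all
    [t >= 0]. Neither the gradient field nor an inverse of the metric is differentiated: gradient
    and acceleration come pointwise from Riesz representation; the first is a test vector in the
    Euler-Lagrange equations, the second is Lipschitz by coercivity. Schwarz's theorem makes both
    the equations and [dmu] independent of the chart. *)

Lemma linear_homog (R : pzRingType) (V : lmodType R) (F : V -> R) a x :
  scalar F -> F (a *: x) = a * F x.
Proof.
move=> lF; have F0 : F 0 = 0.
  by have := lF (-1) 0 0; rewrite scaler0 addr0 mulN1r addNr.
by have := lF a x 0; rewrite F0 !addr0.
Qed.

(** * Differentials *)

Section Differentials.
Context {R : realType}.
Implicit Types V W : normedModType R.

(** The little-o expansion of [f] at [x] is also one for [g], and uniqueness of the differential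
    identifies the two. Charts call for this repeatedly: [chart_inv i] inverts [chart i] only on an
    open set, so the identities between compositions hold only locally. *)
Lemma is_diff_near V W (f g : V -> W) (x : V) df :
  (\forall y \near x, f y = g y) -> is_diff x f df -> is_diff x g df.
Proof.
move=> fg [fx dfE].
have fgx : f x = g x := nbhs_singleton fg.
have [dc fo] := (diff_locallyP x f).1 fx.
have H : g \o shift x = cst (g x) + 'd f x +o_ (0 : V) id.
  apply/eqaddoP => e e0.
  have fo' := (eqaddoP _ _ _ _).1 fo _ e0.
  have fg0 : \forall y \near (0 : V), f (y + x) = g (y + x).
    by move: fg; rewrite (near_shift 0) /=; apply: filterS => y /=; rewrite subr0.
  apply: filterS2 fo' fg0 => y; rewrite !fctE /= -fgx => + yE.
  by rewrite -yE.
have E : 'd g x = 'd f x :> (V -> W) by exact: diff_unique.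
split; last by rewrite E.
by apply/diff_locallyP; rewrite E; split.
Qed.

Lemma is_diff_open V W (A : set V) (f g : V -> W) (x : V) df :
  open A -> A x -> {in A, f =1 g} -> is_diff x f df -> is_diff x g df.
Proof.
move=> oA Ax fg; apply: is_diff_near.
have : nbhs x A by apply: open_nbhs_nbhs.
by apply: filterS => y /mem_set /fg.
Qed.

Lemma is_diff_uniq V W (f : V -> W) (x : V) df dg :
  is_diff x f df -> is_diff x f dg -> df = dg.
Proof. by move=> [_ <-] [_ <-]. Qed.

Lemma is_diff_lin V W (f : V -> W) (x : V) : linear f -> continuous f -> is_diff x f f.
Proof.
move=> lf cf.
pose fM := GRing.isLinear.Build _ _ _ _ _ lf.
pose fL : {linear V -> W} := HB.pack f fM.
rewrite -[f]/(fL : V -> W); split; first exact: linear_differentiable.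
exact: diff_lin.
Qed.

Lemma is_diff_derive V W (f : V -> W) (x v : V) df :
  is_diff x f df -> is_derive x v f (df v).
Proof.
move=> [fx <-]; apply: DeriveDef; first exact: diff_derivable.
exact: deriveE.
Qed.

Lemma is_derive_diff W (f : R -> W) (t : R) df :
  is_derive t 1 f df -> is_diff t f (fun h => h *: df).
Proof.
move=> [ft <-]; split; first exact/derivable1_diffP.
by rewrite diff1E ?derive1E//; exact/derivable1_diffP.
Qed.

Lemma is_diff_scale V W (k : V -> R) (f : V -> W) (x : V) dk df :
  is_diff x k dk -> is_diff x f df ->
  is_diff x (fun y => k y *: f y) (fun v => k x *: df v + dk v *: f x).
Proof.
have lb : bilinear_for
    (GRing.Scale.Law.clone _ _ *:%R _) (GRing.Scale.Law.clone _ _ *:%R _)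
    (fun (a : R) (w : W) => a *: w).
  split=> [u'|u] a x' y /=.
  - by rewrite scalerDl scalerA.
  - by rewrite scalerDr !scalerA mulrC.
pose bM := bilinear_isBilinear.Build R R W W _ _ (fun (a : R) (w : W) => a *: w) lb.
pose b : {bilinear R -> W -> W} := HB.pack (fun (a : R) (w : W) => a *: w) bM.
have bc : continuous (fun p : R * W => b p.1 p.2).
  by move=> p; exact: (@scale_continuous R W p).
move=> kx fx.
have H : is_diff (k x, f x) (fun p : R * W => b p.1 p.2) (fun q => k x *: q.2 + q.1 *: f x).
  split; first exact: differentiable_bilin.
  by rewrite diff_bilin.
exact: (@is_diff_comp _ _ _ _ (fun y => (k y, f y)) (fun v => (dk v, df v))).
Qed.

Lemma is_diff_sumr V W n (f df : 'I_n -> V -> W) (x : V) :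
  (forall i, is_diff x (f i) (df i)) ->
  is_diff x (fun y => \sum_i f i y) (fun v => \sum_i df i v).
Proof.
elim: n f df => [|n IH] f df H.
  rewrite (_ : (fun y => _) = cst 0); last by apply/funext => y; rewrite big_ord0.
  rewrite (_ : (fun v => _) = 0); first exact: is_diff_cst.
  by apply/funext => y; rewrite big_ord0.
under eq_fun do rewrite big_ord_recl.
under [X in is_diff _ _ X]eq_fun do rewrite big_ord_recl.
by apply: is_diffD; apply: IH.
Qed.

Lemma is_diff_fst V W (z : V * W) : is_diff z fst fst.
Proof. by apply: is_diff_lin => // y; exact: cvg_fst. Qed.

Lemma is_diff_snd V W (z : V * W) : is_diff z snd snd.
Proof. by apply: is_diff_lin => // y; exact: cvg_snd. Qed.

Lemma is_diff_coord n (x : 'rV[R]_n) k :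
  is_diff x (fun u : 'rV[R]_n => u 0 k) (fun u => u 0 k).
Proof.
apply: is_diff_lin; last exact: coord_continuous.
by move=> a u v; rewrite !mxE.
Qed.

(** Expansion on the basis reduces differentiability, C^k regularity and bounds of families of
    linear maps to finitely many fixed vectors. Linearity is a bare proposition here, because the
    families met later are not bundled. *)
Lemma linear_row n (W : lmodType R) (F : 'rV[R]_n -> W) : linear F ->
  forall u, F u = \sum_k u 0 k *: F (delta_mx 0 k).
Proof.
move=> lF u.
pose fM := GRing.isLinear.Build _ _ _ _ _ lF.
pose fL : {linear _ -> _} := HB.pack F fM.
rewrite -[F]/(fL : _ -> _) {1}(row_sum_delta u) linear_sum.
by apply: eq_bigr => k _; rewrite linearZ.
Qed.

Lemma is_diff_row V n (f : V -> 'rV[R]_n) (x : V) (df : 'I_n -> V -> R) :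
  (forall k, is_diff x (fun y => f y 0 k) (df k)) ->
  is_diff x f (fun v => \row_k df k v).
Proof.
move=> H.
have -> : f = (fun y => \sum_k f y 0 k *: delta_mx 0 k).
  by apply/funext => y; exact: row_sum_delta.
have E : (fun v => \row_k df k v) =
    (fun v => \sum_k (f x 0 k *: (0 : 'rV[R]_n) + df k v *: (delta_mx 0 k : 'rV[R]_n))).
  apply/funext => v; rewrite [LHS]row_sum_delta; apply: eq_bigr => k _.
  by rewrite mxE scaler0 add0r.
by rewrite E; apply: is_diff_sumr => k; apply: is_diff_scale.
Qed.

(** Differentiability in [x] for each fixed vector gives joint differentiability, since [F] is a
    finite sum of coordinates times functions of [x]. Linearity of [dF] in the vector is not
    assumed; it follows from uniqueness of the differential. *)
Lemma is_diff_param_linear V W n (F : V -> 'rV[R]_n -> W) (x : V) u dF :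
  (forall y, linear (F y)) -> (forall v, is_diff x (F^~ v) (dF v)) ->
  is_diff (x, u) (fun z => F z.1 z.2) (fun dz => dF u dz.1 + F x dz.2).
Proof.
move=> lF dFx.
have -> : (fun z => F z.1 z.2) =
    (fun z : V * 'rV[R]_n => \sum_k (z.2 0 k : R) *: F z.1 (delta_mx 0 k)).
  by apply/funext => z; exact: linear_row.
have E : (fun dz => dF u dz.1 + F x dz.2) =
    (fun dz : V * 'rV[R]_n => \sum_k (u 0 k *: dF (delta_mx 0 k) dz.1 + dz.2 0 k *: F x (delta_mx 0 k))).
  apply/funext => dz; rewrite big_split /= -linear_row//; congr (_ + _).
  have H : is_diff x (F^~ u) (fun v => \sum_k (u 0 k *: dF (delta_mx 0 k) v)).
    rewrite (_ : F^~ u = fun y => \sum_k (u 0 k *: F y (delta_mx 0 k))); last first.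
      by apply/funext => y; exact: linear_row.
    by apply: is_diff_sumr => k; apply: is_diffZ.
  by rewrite (is_diff_uniq (dFx u) H).
rewrite E; apply: is_diff_sumr => k.
apply: (@is_diff_scale _ _ (fun z : V * 'rV[R]_n => z.2 0 k)
  (fun z => F z.1 (delta_mx 0 k)) (x, u) (fun dz => dz.2 0 k)
  (fun dz => dF (delta_mx 0 k) dz.1)).
- exact: (@is_diff_comp _ _ _ _ snd snd (fun w : 'rV[R]_n => w 0 k)
    (fun w => w 0 k) (x, u) (is_diff_snd _) (is_diff_coord _ _)).
- exact: (@is_diff_comp _ _ _ _ fst fst (F^~ (delta_mx 0 k)) _ (x, u)
    (is_diff_fst _) (dFx _)).
Qed.

(** Leibniz rule for a field of linear maps along [c] paired with a moving vector [a]. A second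
    application, with [c := id], treats quadratic expressions such as the kinetic energy along a
    curve. *)
Lemma is_diff_param_linear_comp V' V W n (F : V -> 'rV[R]_n -> W)
    (c : V' -> V) (a : V' -> 'rV[R]_n) (s : V') dc da dF :
  (forall y, linear (F y)) -> (forall v, is_diff (c s) (F^~ v) (dF v)) ->
  is_diff s c dc -> is_diff s a da ->
  is_diff s (fun y => F (c y) (a y)) (fun h => dF (a s) (dc h) + F (c s) (da h)).
Proof.
move=> lF dFx cs as_.
exact: (@is_diff_comp _ _ _ _ (fun y => (c y, a y)) (fun h => (dc h, da h))
  (fun z => F z.1 z.2) (fun dz => dF (a s) dz.1 + F (c s) dz.2) s
  (is_diff_pair cs as_) (is_diff_param_linear (a s) lF dFx)).
Qed.

End Differentials.

(** * Maps of class C^k *)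

Section Ck_calculus.
Context {R : realType}.
Implicit Types V W : normedModType R.

Lemma Ck_is_diff V W k (A : set V) (f : V -> W) x :
  Ck k.+1 A f -> A x -> is_diff x f ('d f x).
Proof. by move=> [fA _] Ax; apply: differentiableP; exact: fA. Qed.

Lemma Ck_ext V W k (A : set V) (f g : V -> W) :
  open A -> {in A, f =1 g} -> Ck k A f -> Ck k A g.
Proof.
move=> oA; elim: k f g => [|k IH] f g fg.
  move=> /= fA x Ax.
  have fgx : \forall y \near x, f y = g y.
    have : nbhs x A by apply: open_nbhs_nbhs.
    by apply: filterS => y /mem_set /fg.
  rewrite /prop_for /continuous_at -fg ?inE//; apply: cvg_trans (fA x Ax).
  by apply: near_eq_cvg; apply: filterS fgx.
move=> fA; have [fd fC] := fA; split=> [x Ax|v].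
  have /(is_diff_open oA Ax fg)[] // := Ck_is_diff fA Ax.
apply: IH (fC v) => x /set_mem Ax.
by have /(is_diff_open oA Ax fg)[_ ->] := Ck_is_diff fA Ax.
Qed.

Lemma Ck_sub V W k (A B : set V) (f : V -> W) : B `<=` A -> Ck k A f -> Ck k B f.
Proof.
move=> BA; elim: k f => [|k IH] f /=; first by move=> fA x /BA; exact: fA.
by move=> [fA fC]; split=> [x /BA|v]; [exact: fA|exact: IH].
Qed.

Lemma Ck_pred V W k (A : set V) (f : V -> W) : Ck k.+1 A f -> Ck k A f.
Proof.
elim: k f => [|k IH] f.
  by move=> [fA _] x Ax; apply: differentiable_continuous; exact: fA.
by move=> [fA fC]; split => // v; apply: IH; exact: fC.
Qed.

(** Meant for a union of solutions, where the representative [g] changes from point to point. *)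
Lemma Ck_local V W k (A : set V) (f : V -> W) :
  (forall x, A x -> exists B g, [/\ open B, B x, {in B, g =1 f} & Ck k B g]) ->
  Ck k A f.
Proof.
elim: k f => [|k IH] f H.
  move=> x /H[B [g [oB Bx gf gB]]].
  by have : Ck 0 B f := Ck_ext oB gf gB; apply.
split=> [x /H[B [g [oB Bx gf gB]]]|v].
  by have [+ _] := Ck_ext oB gf gB; apply.
apply: IH => x /H[B [g [oB Bx gf gB]]]; exists B, (fun y => 'd f y v); split => //.
by have [_] := Ck_ext oB gf gB; apply.
Qed.

Lemma Ck_cst V W k (A : set V) (w : W) : Ck k A (fun=> w).
Proof.
elim: k w => [|k IH] w; first by move=> x _; exact: cvg_cst.
split=> [x _|v]; first exact: differentiable_cst.
rewrite (_ : (fun x => _) = fun=> 0) //.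
by apply/funext => x; rewrite (@diff_cst R V W w x).
Qed.

Lemma CkD V W k (A : set V) (f g : V -> W) : open A ->
  Ck k A f -> Ck k A g -> Ck k A (fun x => f x + g x).
Proof.
move=> oA; elim: k f g => [|k IH] f g.
  by move=> fA gA x Ax; apply: cvgD; [exact: fA|exact: gA].
move=> fA gA.
have D x : A x -> is_diff x (fun x => f x + g x) (fun v => 'd f x v + 'd g x v).
  by move=> Ax; exact: is_diffD (Ck_is_diff fA Ax) (Ck_is_diff gA Ax).
split=> [x /D[]//|v].
apply: (@Ck_ext _ _ _ _ (fun x => 'd f x v + 'd g x v)) => //.
  by move=> x /set_mem /D[_ ->].
by apply: IH; [case: fA => _; apply|case: gA => _; apply].
Qed.

Lemma Ck_sum V W k (A : set V) n (f : 'I_n -> V -> W) : open A ->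
  (forall i, Ck k A (f i)) -> Ck k A (fun x => \sum_i f i x).
Proof.
move=> oA; elim: n f => [|n IH] f fA.
  under eq_fun do rewrite big_ord0; exact: Ck_cst.
under eq_fun do rewrite big_ord_recl.
by apply: CkD => //; exact: IH.
Qed.

Lemma Ck_scale V W k (A : set V) (a : V -> R) (f : V -> W) : open A ->
  Ck k A a -> Ck k A f -> Ck k A (fun x => a x *: f x).
Proof.
move=> oA; elim: k a f => [|k IH] a f.
  by move=> fA gA x Ax; apply: cvgZ; [exact: fA|exact: gA].
move=> aA fA.
have D x : A x -> is_diff x (fun x => a x *: f x) (fun v => a x *: 'd f x v + 'd a x v *: f x).
  by move=> Ax; exact: is_diff_scale (Ck_is_diff aA Ax) (Ck_is_diff fA Ax).
split=> [x /D[]//|v].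
apply: (@Ck_ext _ _ _ _ (fun x => a x *: 'd f x v + 'd a x v *: f x)) => //.
  by move=> x /set_mem /D[_ ->].
apply: CkD => //; apply: IH => //; try exact: Ck_pred.
  by case: fA => _; apply.
by case: aA => _; apply.
Qed.

Lemma Ck_coord V n k (A : set V) (f : V -> 'rV[R]_n) i : open A ->
  Ck k A f -> Ck k A (fun x => f x 0 i).
Proof.
move=> oA; elim: k f => [|k IH] f.
  by move=> fA x Ax; apply: (cvg_comp f (fun u : 'rV[R]_n => u 0 i)); [exact: fA|exact: coord_continuous].
move=> fA.
have D x : A x -> is_diff x (fun x => f x 0 i) (fun v => 'd f x v 0 i).
  move=> Ax; exact: (@is_diff_comp _ _ _ _ f _ (fun u : 'rV[R]_n => u 0 i)
    (fun u => u 0 i) x (Ck_is_diff fA Ax) (is_diff_coord _ _)).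
split=> [x /D[]//|v].
apply: (@Ck_ext _ _ _ _ (fun x => 'd f x v 0 i)) => //.
  by move=> x /set_mem /D[_ ->].
by apply: IH; case: fA => _; apply.
Qed.

(** In ['d T (c x) ('d c x v)] both the map and the vector depend on [x]. Expanded on the basis of
    the middle space it becomes a sum of products, to which the induction hypothesis applies for
    each ['d T] on a fixed basis vector. *)
Lemma Ck_comp V W n k (A : set V) (B : set 'rV[R]_n) (c : V -> 'rV[R]_n)
    (T : 'rV[R]_n -> W) : open A -> (forall x, A x -> B (c x)) ->
  Ck k A c -> Ck k B T -> Ck k A (T \o c).
Proof.
move=> oA cAB; elim: k W T => [|k IH] W T.
  by move=> cA TB x Ax; apply: continuous_comp; [exact: cA|apply: TB; exact: cAB].
move=> cA TB.
have D x : A x -> is_diff x (T \o c) ('d T (c x) \o 'd c x).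
  by move=> Ax; exact: (@is_diff_comp _ _ _ _ c _ T _ x (Ck_is_diff cA Ax) (Ck_is_diff TB (cAB _ Ax))).
split=> [x /D[]//|v].
apply: (@Ck_ext _ _ _ _ (fun x => \sum_j ('d c x v 0 j) *: ('d T (c x) (delta_mx 0 j)))) => //.
  by move=> x /set_mem /D[_ ->] /=; rewrite -linear_row//; exact: linearP.
apply: Ck_sum => // j; apply: Ck_scale => //.
  by apply: Ck_coord => //; case: cA => _; apply.
apply: (IH _ (fun y => 'd T y (delta_mx 0 j))); first exact: Ck_pred.
by case: TB => _; apply.
Qed.

Lemma is_derive_line V W (f : V -> W) (y v : V) (s : R) :
  differentiable f (s *: v + y) ->
  is_derive s 1 (fun s => f (s *: v + y)) ('d f (s *: v + y) v).
Proof.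
move=> fd.
have D : is_diff s (fun s : R => s *: v + y) (fun h : R => h *: v).
  rewrite (_ : (fun h : R => h *: v) = (fun h : R => s *: 0 + h *: v + 0)); last first.
    by apply/funext => h; rewrite scaler0 add0r addr0.
  apply: is_diffD; apply: is_diff_scale.
have := @is_diff_comp _ _ _ _ _ _ f _ s D (differentiableP fd).
by move=> /is_diff_derive -/(_ (1 : R)) /=; rewrite scale1r.
Qed.

Lemma MVT_is_derive (f df : R -> R) (a b : R) : a < b ->
  (forall x, a <= x <= b -> is_derive x 1 f (df x)) ->
  exists2 c, a < c < b & f b - f a = df c * (b - a).
Proof.
move=> ab fd.
have [||c + ->] := @MVT R f df a b ab.
- by move=> x; rewrite in_itv /= => /andP[/ltW ax /ltW xb]; apply: fd; rewrite ax.
- apply: derivable_within_continuous => x; rewrite in_itv /= => /fd[].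
  by [].
- by rewrite in_itv /= => cab; exists c.
Qed.

(* Symmetric in [v] and [w] on the left: this is Schwarz's theorem up to the
   continuity of the second derivatives. *)
Lemma second_difference V (A : set V) (f : V -> R) (x v w : V) (h : R) :
  Ck 2 A f -> 0 < h ->
  (forall s t, 0 <= s <= h -> 0 <= t <= h -> A (s *: v + (t *: w + x))) ->
  exists s t, [/\ 0 <= s <= h, 0 <= t <= h &
    f (h *: v + (h *: w + x)) - f (h *: v + x) - (f (h *: w + x) - f x) =
    'd (fun y => 'd f y v) (s *: v + (t *: w + x)) w * (h * h)].
Proof.
move=> fA h0 xA.
have hh : 0 <= h <= h by rewrite (ltW h0) lexx.
have h00 : (0 : R) <= 0 <= h by rewrite lexx (ltW h0).
have [fd fC] := fA.
have [//|s /andP[s0 sh] sE] := @MVT_is_derive (fun s => f (s *: v + (h *: w + x)) - f (s *: v + x))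
   (fun s => 'd f (s *: v + (h *: w + x)) v - 'd f (s *: v + x) v) 0 h h0.
  move=> s sh; apply: is_deriveB; apply: is_derive_line; apply: fd; first exact: xA.
  by have := xA s 0 sh h00; rewrite scale0r add0r.
have [//|t /andP[t0 th] tE] := @MVT_is_derive (fun t => 'd f (s *: v + (t *: w + x)) v)
   (fun t => 'd (fun y => 'd f y v) (s *: v + (t *: w + x)) w) 0 h h0.
  move=> t th.
  have := @is_derive_line _ _ (fun y => 'd f y v) (s *: v + x) w t.
  rewrite addrCA; under [X in is_derive _ _ X]eq_fun do rewrite addrCA.
  apply; have [+ _] := fC v; apply; apply: xA => //.
  by rewrite (ltW s0) (ltW sh).
exists s, t; split; [by rewrite (ltW s0) (ltW sh)|by rewrite (ltW t0) (ltW th)|].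
move: sE; rewrite subr0 !scale0r !add0r => ->.
move: tE; rewrite subr0 !scale0r !add0r => ->.
by rewrite mulrA.
Qed.

Lemma near_small_combination V (x v w : V) (P : V -> Prop) : (\forall y \near x, P y) ->
  exists2 h : R, 0 < h & forall s t, 0 <= s <= h -> 0 <= t <= h -> P (s *: v + (t *: w + x)).
Proof.
move=> /nbhs_ballP[e /= e0 eP].
pose K := `|v| + `|w| + 1.
have K0 : 0 < K by rewrite ltr_wpDl // addr_ge0.
exists (e / K); first by rewrite divr_gt0.
move=> s t /andP[s0 se] /andP[t0 te]; apply: eP.
rewrite -ball_normE /= addrA opprD addrCA subrr addr0 normrN.
apply: (le_lt_trans (ler_normD _ _)); rewrite !normrZ !ger0_norm //.
apply: (@le_lt_trans _ _ (e / K * `|v| + e / K * `|w|)).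
  by apply: lerD; apply: ler_wpM2r.
rewrite -mulrDr mulrAC ltr_pdivrMr // ltr_pM2l //.
by rewrite /K ltrDl.
Qed.

(** Exchanging [v] and [w] leaves the second difference unchanged, so it equals [h * h] times either
    mixed derivative, each taken at some point near [x]. Continuity at [x] then brings the two
    derivatives within any [e] of each other. *)
Lemma diff2_sym V (A : set V) (f : V -> R) (x v w : V) : open A -> A x -> Ck 2 A f ->
  'd (fun y => 'd f y v) x w = 'd (fun y => 'd f y w) x v.
Proof.
move=> oA Ax fA.
have C u u' : {for x, continuous (fun y => 'd (fun y => 'd f y u) y u')}.
  by have [_ /(_ u)[_ /(_ u')]] := fA; apply.
apply/eqP; rewrite -subr_eq0 -normr_le0; apply/ler_addgt0Pl => e e0; rewrite addr0.
have xA : \forall y \near x, A y by apply: open_nbhs_nbhs.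
have e2 : 0 < e / 2 by rewrite divr_gt0.
have E1 : \forall y \near x, `|'d (fun y => 'd f y v) x w - 'd (fun y => 'd f y v) y w| < e / 2.
  by have /cvgrPdist_lt := C v w; apply.
have E2 : \forall y \near x, `|'d (fun y => 'd f y w) x v - 'd (fun y => 'd f y w) y v| < e / 2.
  by have /cvgrPdist_lt := C w v; apply.
have [h h0 hP] := near_small_combination v w (filterI xA (filterI E1 E2)).
have [s [t [sh th E]]] := second_difference fA h0 (fun s t sh th => (hP s t sh th).1).
have hP' s' t' : 0 <= s' <= h -> 0 <= t' <= h -> A (s' *: w + (t' *: v + x)).
  by move=> s'h t'h; rewrite addrCA; have [] := hP _ _ t'h s'h.
have [s' [t' [s'h t'h E']]] := second_difference fA h0 hP'.
have [_ [H1 _]] := hP _ _ sh th.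
have [_ [_ H2]] := hP _ _ t'h s'h.
rewrite [t' *: _ + _]addrCA in H2.
have EE : 'd (fun y => 'd f y v) (s *: v + (t *: w + x)) w = 'd (fun y => 'd f y w) (s' *: w + (t' *: v + x)) v.
  have hh : h * h != 0 by rewrite mulf_neq0 // gt_eqF.
  by apply: (mulIf hh); rewrite -E -E' [h *: v + (h *: w + x)]addrCA; ring.
rewrite EE in H1.
set a := 'd _ x w in H1 *; set b := 'd _ x v in H2 *; set c := 'd _ _ v in H1 H2.
rewrite (splitr e) (_ : a - b = (a - c) - (b - c)); last by ring.
by apply: (le_trans (ler_normB _ _)); apply: lerD; exact: ltW.
Qed.

Lemma diff2_sym_row V n (A : set V) (f : V -> 'rV[R]_n) (x v w : V) :
  open A -> A x -> Ck 2 A f ->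
  'd (fun y => 'd f y v) x w = 'd (fun y => 'd f y w) x v.
Proof.
move=> oA Ax fA; apply/rowP => k.
have fAk := Ck_coord k oA fA.
have D y u : A y -> 'd (fun x => f x 0 k) y u = 'd f y u 0 k.
  move=> Ay; have [_ ->] // := @is_diff_comp _ _ _ _ f _ (fun u : 'rV[R]_n => u 0 k)
    (fun u => u 0 k) y (Ck_is_diff fA Ay) (is_diff_coord _ _).
have [_ fC] := fA.
have D2 u u' : 'd (fun y => 'd f y u) x u' 0 k = 'd (fun y => 'd (fun x => f x 0 k) y u) x u'.
  have := @is_diff_comp _ _ _ _ (fun y => 'd f y u) _ (fun u : 'rV[R]_n => u 0 k)
    (fun u => u 0 k) x (Ck_is_diff (k := 0) (A := A) (x := x) (fC u) Ax) (is_diff_coord _ _).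
  have H : {in A, (fun u0 : 'rV[R]_n => u0 0 k) \o (fun y => 'd f y u) =1 (fun y => 'd (fun x => f x 0 k) y u)}.
    by move=> y /set_mem Ay /=; rewrite D.
  by move=> /(is_diff_open oA Ax H)[_ ->].
by rewrite !D2; exact: diff2_sym fAk.
Qed.

End Ck_calculus.

(** * Picard iteration *)

Section Picard.
Context {R : realType}.

Lemma is_diff_derive1 (W : normedModType R) (f : R -> W) (t : R) df :
  is_diff t f df -> is_derive t 1 f (df 1).
Proof. exact: is_diff_derive. Qed.

Lemma row_norm_le n (u : 'rV[R]_n) (c : R) : 0 <= c ->
  (`|u| <= c) <-> (forall k, `|u 0 k| <= c).
Proof.
move=> c0; rewrite {1}/Num.Def.normr /= mx_normrE; split=> [H k|H].
  by apply: le_trans H; apply: (le_bigmax _ _ (0, k)).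
by apply: bigmax_le => // -[i k] _ /=; rewrite ord1.
Qed.

Lemma coord_le_norm n (u : 'rV[R]_n) k : `|u 0 k| <= `|u|.
Proof. exact: ((row_norm_le u (normr_ge0 u)).1 (lexx _) k). Qed.

(** The projection of the line onto [[-r, r]]. It serves twice: on time, to define the Picard
    operator on the whole line, and on coordinates, to extend a locally Lipschitz field. *)
Definition clamp (r x : R) : R :=
  if x < - r then - r else if r < x then r else x.

Lemma clamp_dist r x y : 0 <= r -> `|clamp r x - clamp r y| <= `|x - y|.
Proof.
move=> r0; rewrite /clamp ler_norml lerNl !ler_normr.
by case: (ltP x (- r)) => ?; case: (ltP r x) => ?; case: (ltP y (- r)) => ?;
  case: (ltP r y) => ?; case: (leP x y) => ?; apply/andP; split; apply/orP;
  ((left; lra) || (right; lra)).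
Qed.

Lemma clamp_norm r x : 0 <= r -> `|clamp r x| <= r.
Proof.
by move=> r0; rewrite /clamp ler_norml; case: (ltP x (- r)) => ?;
  case: (ltP r x) => ?; apply/andP; split; lra.
Qed.

Lemma clamp_id r x : `|x| <= r -> clamp r x = x.
Proof.
by rewrite ler_norml /clamp => /andP[? ?]; case: (ltP x (- r)) => ?;
  case: (ltP r x) => ?; lra.
Qed.

Lemma lipschitz_continuous (V W : normedModType R) (f : V -> W) (L : R) : 0 < L ->
  (forall x y, `|f x - f y| <= L * `|x - y|) -> continuous f.
Proof.
move=> L0 fL x; apply/cvgrPdist_lt => e e0.
have : \forall y \near x, `|x - y| < e / L.
  by apply/nbhs_ballP; exists (e / L) => /=; [rewrite divr_gt0|rewrite -ball_normE].
apply: filterS => y xy; apply: le_lt_trans (fL _ _) _.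
by rewrite mulrC -ltr_pdivlMr.
Qed.

Lemma primitive_exists (h : R -> R) (T a0 : R) : 0 < T -> continuous h ->
  exists2 F : R -> R, F 0 = a0 & forall t : R, `|t| < T -> is_derive t 1 F (h t).
Proof.
move=> T0 hc.
(* Starting the integral at [- T] makes every [t] with [|t| < T] an interior point, so negative
   times need no separate case; the value at 0 is adjusted afterwards. *)
pose F x := (\int[lebesgue_measure]_(t in `[- T, x]) h t)%R.
have FP (t : R) : `|t| < T -> is_derive t 1 F (h t).
  rewrite ltr_norml => /andP[tT1 tT2].
  have [] := @continuous_FTC1_closed R h (- T) t T tT2 _ tT1 (hc t).
    apply: continuous_compact_integrable; first exact: segment_compact.
    exact: continuous_subspaceT.
  by move=> Fd FE; split; [exact: Fd|rewrite -derive1E; exact: FE].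
exists (fun t => F t + (a0 - F 0)); first by rewrite addrC subrK.
move=> t /FP Ft.
rewrite -[h t]addr0; apply: is_deriveD.
Qed.

Lemma is_derive_row n (f : R -> 'rV[R]_n) (t : R) (df : 'I_n -> R) :
  (forall k, is_derive t 1 (fun y => f y 0 k) (df k)) ->
  is_derive t 1 f (\row_k df k).
Proof.
move=> H; have /is_diff_derive1 := is_diff_row (fun k => is_derive_diff (H k)).
by under eq_mx do rewrite scale1r.
Qed.

Lemma is_derive_coord n (f : R -> 'rV[R]_n) (t : R) df k :
  is_derive t 1 f df -> is_derive t 1 (fun y => f y 0 k) (df 0 k).
Proof.
move=> /is_derive_diff H.
have := @is_diff_comp _ _ _ _ f _ (fun u : 'rV[R]_n => u 0 k)
  (fun u => u 0 k) t H (is_diff_coord _ _).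
by move=> /is_diff_derive1 /=; rewrite scale1r.
Qed.

Lemma primitive_row_exists n (h : R -> 'rV[R]_n) (T : R) (a0 : 'rV[R]_n) :
  0 < T -> continuous h ->
  exists2 F : R -> 'rV[R]_n, F 0 = a0 & forall t : R, `|t| < T -> is_derive t 1 F (h t).
Proof.
move=> T0 hc.
have H k : exists F : R -> R, F 0 = a0 0 k /\ forall t : R, `|t| < T -> is_derive t 1 F (h t 0 k).
  have [|F] := @primitive_exists (fun t => h t 0 k) T (a0 0 k) T0; last by exists F.
  by move=> t; apply: (cvg_comp h (fun u : 'rV[R]_n => u 0 k)); [exact: hc|exact: coord_continuous].
have /choice[F FP] := H.
exists (fun t => \row_k F k t); first by apply/rowP => k; rewrite mxE; case: (FP k).
move=> t tT; rewrite (_ : h t = \row_k h t 0 k); last by apply/rowP => k; rewrite mxE.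
apply: is_derive_row => k; under eq_fun do rewrite mxE.
by have [_] := FP k; apply.
Qed.

(** The scalar mean value theorem applies to each coordinate; as ['rV] carries the max norm, no
    constant depending on [n] appears. *)
Lemma mean_value_row n (f df : R -> 'rV[R]_n) (t K T : R) : 0 <= K -> `|t| < T ->
  (forall s : R, `|s| < T -> is_derive s 1 f (df s)) ->
  (forall s, `|s| < T -> `|df s| <= K) ->
  `|f t - f 0| <= K * `|t|.
Proof.
move=> K0 tT fd dfK; apply/row_norm_le; first by rewrite mulr_ge0.
move=> k; rewrite !mxE.
have D (s : R) : `|s| < T -> is_derive s 1 (fun s => f s 0 k) (df s 0 k).
  by move=> /fd; exact: is_derive_coord.
have B s : `|s| < T -> `|df s 0 k| <= K.
  by move=> /dfK; exact: le_trans (coord_le_norm _ _).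
have [t0|t0|->] := ltgtP t 0; last by rewrite subrr !normr0 mulr0.
- have [|c /andP[c1 c2] E] := @MVT_is_derive R (fun s => f s 0 k) (fun s => df s 0 k) t 0 t0.
    move=> x /andP[tx x0]; apply: D; apply: le_lt_trans tT.
    by rewrite !ler0_norm ?lerN2 // ltW.
  rewrite distrC E normrM distrC subr0 ler_wpM2r //; apply: B.
  by apply: lt_trans tT; rewrite !ltr0_norm ?ltrN2 //.
- have [|c /andP[c1 c2] E] := @MVT_is_derive R (fun s => f s 0 k) (fun s => df s 0 k) 0 t t0.
    move=> x /andP[tx x0]; apply: D; apply: le_lt_trans tT.
    by rewrite !ger0_norm // ltW.
  rewrite E normrM subr0 ler_wpM2r //; apply: B.
  by apply: lt_trans tT; rewrite !gtr0_norm.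
Qed.

Lemma geometric_small (C e : R) : 0 < e -> \forall k \near \oo, C / 2 ^+ k < e.
Proof.
move=> e0.
have : (fun k => C * (2^-1 : R) ^+ k) @ \oo --> C * (0 : R).
  apply: cvgMl_tmp; apply: cvg_expr.
  by rewrite ger0_norm ?invr_ge0 // invf_lt1 ?ltr1n.
rewrite mulr0 => /cvgrPdist_lt /(_ e e0); apply: filterS => k.
rewrite sub0r normrN; apply: le_lt_trans.
by rewrite exprVn ler_norm.
Qed.

(** The geometric tail sums to [2 C / 2^k]. This explicit rate makes the pointwise limits of the
    Picard iterates uniform in time. *)
Lemma geometric_cvg n (u : nat -> 'rV[R]_n) (C : R) : 0 <= C ->
  (forall k, `|u k.+1 - u k| <= C / 2 ^+ k) ->
  exists l : 'rV[R]_n, forall k, `|u k - l| <= C * 2 / 2 ^+ k.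
Proof.
move=> C0 uC.
have B j k : `|u (k + j)%N - u k| <= C * 2 / 2 ^+ k.
  elim: j k => [|j IH] k.
    by rewrite addn0 subrr normr0 !mulr_ge0 // invr_ge0 exprn_ge0.
  rewrite addnS -addSn -(subrK (u k.+1) (u _)) -addrA.
  apply: (le_trans (ler_normD _ _)); apply: (le_trans (lerD (IH _) (uC _))).
  have p0 : (2 : R) ^+ k != 0 by rewrite expf_neq0.
  rewrite exprS (_ : C * 2 / (2 * 2 ^+ k) = C / 2 ^+ k); last by field.
  by rewrite (_ : C / 2 ^+ k + C / 2 ^+ k = C * 2 / 2 ^+ k); last field.
have cu : cvg (u @ \oo).
  apply: cauchy_cvg; apply/cauchy_ballP => e e0.
  have e2 : 0 < e / 2 by rewrite divr_gt0.
  have [N _ NP] := geometric_small (C * 2) e2.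
  exists ([set x | ball (u N) (e / 2) x], [set x | ball (u N) (e / 2) x]) => /=.
    split; exists N => // k /= Nk; rewrite -ball_normE /= -(subnKC Nk) distrC;
    by apply: le_lt_trans (B _ _) (NP N (leqnn _)).
  by move=> [x y] /= [xN yN]; exact: ball_splitr xN yN.
exists (lim (u @ \oo)) => k.
have H : (fun j => `|u k - u j|) @ \oo --> `|u k - lim (u @ \oo)|.
  by apply: cvg_norm; apply: cvgB => //; exact: cvg_cst.
rewrite -(cvg_lim _ H) //; apply: limr_le; first by apply/cvg_ex; exists (`|u k - lim (u @ \oo)|).
exists k => // j /= kj; rewrite distrC -(subnKC kj); exact: B.
Qed.

End Picard.

Section PicardTheorem.
Context {R : realType}.

Lemma is_derive_continuous (W : normedModType R) (f : R -> W) (t : R) df :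
  is_derive t 1 f df -> {for t, continuous f}.
Proof.
by move=> /is_derive_diff[fd _]; exact: differentiable_continuous.
Qed.

Lemma picard_global n (H : 'rV[R]_n -> 'rV[R]_n) (z0 : 'rV[R]_n) (L : R) :
  0 < L -> (forall x y, `|H x - H y| <= L * `|x - y|) ->
  exists2 d : R, 0 < d & exists2 z : R -> 'rV[R]_n, z 0 = z0 &
    forall t : R, `|t| < d -> is_derive t 1 z (H (z t)).
Proof.
move=> L0 HL.
have Hc := lipschitz_continuous L0 HL.
(* With [L * d = 1/2] the integral operator halves distances. *)
pose d : R := (2 * L)^-1.
have d0 : 0 < d by rewrite invr_gt0 mulr_gt0.
have dL : L * d = 2^-1 by rewrite /d; field; rewrite gt_eqF.
have d2 : 0 < 2 * d by rewrite mulr_gt0.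
(* [P w] is the primitive of [H \o w] starting at [z0]. It is controlled up to [2 * d] so that the
   closed interval [[-d, d]], the range of clamped time, lies in the interior. *)
have /choice[P PP] : forall w : R -> 'rV[R]_n, exists P : R -> 'rV[R]_n, continuous w ->
    P 0 = z0 /\ forall t : R, `|t| < 2 * d -> is_derive t 1 P (H (w t)).
  move=> w; have [wc|nwc] := pselect (continuous w); last by exists w.
  have Hwc : continuous (H \o w).
    by move=> t; apply: continuous_comp; [exact: wc|exact: Hc].
  by have [F F0 FP] := primitive_row_exists z0 d2 Hwc; exists F.
(* Freezing time outside [[-d, d]] makes [Phi w] a continuous function on the whole line: the
   operator can be iterated, and the estimates hold for every [t]. *)
pose Phi w := P w \o clamp d.
have cd t : `|clamp d t| <= d by apply: clamp_norm; exact: ltW.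
have cdd t : `|clamp d t| < 2 * d by apply: le_lt_trans (cd t) _; rewrite ltr_pMl ?ltr1n.
have clc : continuous (clamp d).
  apply: (@lipschitz_continuous _ _ _ _ (1 : R)) => // x y.
  by rewrite mul1r; apply: clamp_dist; exact: ltW.
have Phic w : continuous w -> continuous (Phi w).
  move=> wc t; have [_ PD] := PP w wc.
  apply: continuous_comp; first exact: clc.
  exact: is_derive_continuous (PD _ (cdd t)).
have Phi_contr w w' C : continuous w -> continuous w' -> 0 <= C ->
    (forall t, `|w t - w' t| <= C) -> forall t, `|Phi w t - Phi w' t| <= C / 2.
  move=> wc wc' C0 wC t; have [P0 PD] := PP w wc; have [P0' PD'] := PP w' wc'.
  have E := @mean_value_row R n (fun t => P w t - P w' t)
    (fun t => H (w t) - H (w' t)) (clamp d t) (L * C) (2 * d).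
  rewrite /Phi /=; move: E; rewrite P0 P0' subrr subr0 => E.
  apply: (le_trans (E _ _ _ _)) => //.
  - by rewrite mulr_ge0 // ltW.
  - by move=> s sd; apply: is_deriveB; [exact: PD|exact: PD'].
  - by move=> s _; apply: le_trans (HL _ _) _; rewrite ler_pM2l.
  - rewrite -dL [L * C]mulrC -mulrA ler_wpM2l // ler_wpM2l //; exact: ltW.
pose w k := iter k Phi (fun=> z0).
have wc k : continuous (w k).
  by elim: k => [|k IH] /=; [move=> t; exact: cvg_cst|exact: Phic].
pose C0 := `|H z0| * d.
have C00 : 0 <= C0 by rewrite mulr_ge0 // ltW.
have wC k t : `|w k.+1 t - w k t| <= C0 / 2 ^+ k.
  elim: k t => [|k IH] t.
    rewrite expr0 divr1 /=; have [P0 PD] := PP _ (wc 0%N).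
    have := @mean_value_row R n (P (w 0%N)) (fun=> H z0) (clamp d t) (`|H z0|) (2 * d).
    rewrite P0 => E; apply: (le_trans (E _ _ _ _)) => //.
    exact: ler_wpM2l.
  rewrite exprS [2 * _]mulrC invfM mulrA; apply: (Phi_contr (w k.+1) (w k)) => //.
  by rewrite mulr_ge0 // invr_ge0 exprn_ge0.
have /choice[z zP] : forall t, exists l : 'rV[R]_n, forall k, `|w k t - l| <= C0 * 2 / 2 ^+ k.
  by move=> t; apply: geometric_cvg => // k; exact: wC.
have small e : 0 < e -> exists k, C0 * 2 / 2 ^+ k < e.
  by move=> /(geometric_small (C0 * 2))[k _ /(_ k (leqnn _))]; exists k.
have zc : continuous z.
  move=> t; apply/cvgrPdist_lt => e e0.
  have e3 : 0 < e / 3 by rewrite divr_gt0.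
  have [k kP] := small _ e3.
  have /cvgrPdist_lt /(_ _ e3) := wc k t; apply: filterS => s sP.
  rewrite (_ : z t - z s = (z t - w k t) + ((w k t - w k s) + (w k s - z s))); last first.
    by rewrite !addrA subrK subrK.
  rewrite (_ : e = e / 3 + (e / 3 + e / 3)); last by field.
  apply: (le_lt_trans (ler_normD _ _)); apply: ltrD.
    by rewrite distrC; apply: le_lt_trans (zP _ _) kP.
  apply: (le_lt_trans (ler_normD _ _)); apply: ltrD => //.
  by apply: le_lt_trans (zP _ _) kP.
have q0 k : 0 <= C0 * 2 / 2 ^+ k.
  by apply: divr_ge0; [exact: mulr_ge0|exact: exprn_ge0].
have zfix : Phi z = z.
  apply/funext => t; apply/eqP; rewrite -subr_eq0 -normr_le0.
  apply/ler_addgt0Pl => e e0; rewrite addr0.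
  have e2 : 0 < e / 2 by rewrite divr_gt0.
  have [k kP] := small _ e2.
  rewrite -(subrKA (w k.+1 t)) (splitr e).
  apply: (le_trans (ler_normD _ _)); apply: lerD.
    rewrite distrC; apply: le_trans (Phi_contr _ _ (C0 * 2 / 2 ^+ k) (wc k) zc _ _ t) _.
    - exact: q0.
    - by move=> s; exact: zP.
    - apply: (@le_trans _ _ (C0 * 2 / 2 ^+ k)); last exact: ltW.
      by have := q0 k; lra.
  apply: (le_trans (zP _ _)); apply: le_trans (ltW kP).
  rewrite (_ : C0 * 2 / 2 ^+ k.+1 = C0 * 2 / 2 ^+ k / 2); first by have := q0 k; lra.
  by rewrite exprS; field; rewrite expf_neq0.
have [P0 PD] := PP z zc.
exists d => //; exists z; first by rewrite -zfix /Phi /= clamp_id ?normr0 ?ltW.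
move=> t td.
have tdd : `|t| < 2 * d by apply: lt_trans td _; rewrite ltr_pMl ?ltr1n.
apply: near_eq_is_derive (PD t tdd).
have : \forall s \near t, `|s| < d.
  have /cvgr_lt : (fun s : R => `|s|) @ t --> `|t| by apply: norm_continuous.
  exact.
apply: filterS => s sd; rewrite -[in RHS]zfix /Phi /= clamp_id //; exact: ltW.
Qed.

(* [G] is replaced by [G \o kap], where [kap] is the coordinatewise retraction
   onto the closed ball of the max norm: it is 1-Lipschitz, so [G \o kap] is
   globally Lipschitz. *)
Lemma picard n (G : 'rV[R]_n -> 'rV[R]_n) (z0 : 'rV[R]_n) (L r : R) :
  0 < L -> 0 < r ->
  (forall x y, `|x - z0| <= r -> `|y - z0| <= r -> `|G x - G y| <= L * `|x - y|) ->
  exists2 d : R, 0 < d & exists2 z : R -> 'rV[R]_n, z 0 = z0 &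
    forall t : R, `|t| < d -> `|z t - z0| < r /\ is_derive t 1 z (G (z t)).
Proof.
move=> L0 r0 GL.
have rr : 0 <= r := ltW r0.
pose kap (x : 'rV[R]_n) : 'rV[R]_n := z0 + \row_k clamp r ((x - z0) 0 k).
have kapr x : `|kap x - z0| <= r.
  rewrite /kap addrC addKr; apply/row_norm_le => // k.
  by rewrite mxE; exact: clamp_norm.
have kapL x y : `|kap x - kap y| <= `|x - y|.
  apply/row_norm_le => // k.
  rewrite /kap opprD addrACA subrr add0r !mxE; apply: le_trans (clamp_dist _ _ rr) _.
  rewrite opprB addrA subrK; have := coord_le_norm (x - y) k.
  by rewrite !mxE.
have kap_id x : `|x - z0| <= r -> kap x = x.
  move=> /(row_norm_le _ rr) H; apply/rowP => k.
  by rewrite /kap !mxE clamp_id; [rewrite addrC subrK|have := H k; rewrite !mxE].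
have [|d d0 [z z00 zP]] := @picard_global n (G \o kap) z0 L L0.
  move=> x y /=; apply: le_trans (GL _ _ (kapr _) (kapr _)) _.
  by rewrite ler_pM2l.
(* For short times [z] stays in the ball where [kap] is the identity, so the modified equation is
   the original one there. *)
have zr : \forall t \near (0 : R), `|z t - z0| < r.
  have : {for 0, continuous z} by apply: is_derive_continuous (zP 0 _); rewrite normr0.
  rewrite /prop_for /continuous_at z00 => /cvgrPdist_lt /(_ _ r0).
  by apply: filterS => t; rewrite distrC.
have /nbhs_ballP[e /= e0 eP] := zr.
exists (Num.min d e); first by rewrite lt_min d0.
exists z => // t; rewrite lt_min => /andP[td te].
have H : `|z t - z0| < r by apply: eP; rewrite -ball_normE /= sub0r normrN.
by split => //; have := zP t td; rewrite /= kap_id // ltW.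
Qed.

End PicardTheorem.

(** * Locally uniform bounds *)

Section Bounds.
Context {R : realType}.
Implicit Types V W : normedModType R.

(* The weight [w] and the extra parameter [A] allow the lemma to be iterated on
   multilinear families, and to be applied to differences [F x - F y] with
   weight [`|x - y|]. *)
Lemma linear_family_bound n (T A : Type) (Fl : set_system T) (FF : Filter Fl)
    (F : T -> A -> 'rV[R]_n -> R) (w : T -> A -> R) :
  (\forall s \near Fl, forall a, linear (F s a)) -> (forall s a, 0 <= w s a) ->
  (forall e, exists C, \forall s \near Fl, forall a, `|F s a e| <= C * w s a) ->
  exists2 C, 0 < C &
    \forall s \near Fl, forall a v, `|F s a v| <= C * w s a * `|v|.
Proof.
move=> lF w0 FC.
have /choice[C CP] : forall k : 'I_n, exists C, \forall s \near Fl, forall a,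
    `|F s a (delta_mx 0 k)| <= C * w s a by move=> k; exact: FC.
have C0 : 0 < \sum_k `|C k| + 1 by rewrite ltr_wpDl // sumr_ge0.
exists (\sum_k `|C k| + 1) => //.
apply: filterS2 lF (filter_forall _ CP) => s ls sC a v.
rewrite (linear_row (ls a)); apply: (le_trans (ler_norm_sum _ _ _)).
apply: (@le_trans _ _ (\sum_k (`|C k| * w s a * `|v|))).
  apply: ler_sum => k _; rewrite normrM mulrC; apply: ler_pM => //.
    apply: le_trans (sC k a) _; rewrite ler_wpM2r //; exact: ler_norm.
  exact: coord_le_norm.
rewrite -mulr_suml -mulr_suml !ler_wpM2r //.
by rewrite lerDl.
Qed.

Lemma bilinear_family_bound n (T A : Type) (Fl : set_system T) (FF : Filter Fl)
    (F : T -> A -> 'rV[R]_n -> 'rV[R]_n -> R) (w : T -> A -> R) :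
  (\forall s \near Fl, forall a u, linear (F s a u)) ->
  (\forall s \near Fl, forall a v, linear (fun u => F s a u v)) ->
  (forall s a, 0 <= w s a) ->
  (forall e f, exists C, \forall s \near Fl, forall a, `|F s a e f| <= C * w s a) ->
  exists2 C, 0 < C &
    \forall s \near Fl, forall a u v, `|F s a u v| <= C * w s a * `|u| * `|v|.
Proof.
move=> l1 l2 w0 FC.
have [||e|C C0 CP] := @linear_family_bound n T (A * 'rV[R]_n) Fl FF (fun s av u => F s av.1 u av.2)
    (fun s av => w s av.1 * `|av.2|).
- by apply: filterS l2 => s sl a; exact: sl.
- by move=> s a; rewrite mulr_ge0.
- have [|||C C0 CP] := @linear_family_bound n T A Fl FF (fun s a v => F s a e v) w.
  + by apply: filterS l1 => s sl a; exact: sl.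
  + by [].
  + exact: FC.
  by exists C; apply: filterS CP => s sP [a v] /=; rewrite mulrA.
exists C => //; apply: filterS CP => s sP a u v.
by have := sP (a, v) u; rewrite /= !mulrA [_ * `|v| * `|u|]mulrAC.
Qed.

Lemma linear_row_is_diff n W (F : 'rV[R]_n -> W) x : linear F -> is_diff x F F.
Proof.
move=> lF.
have D k : is_diff x (fun u : 'rV[R]_n => u 0 k *: F (delta_mx 0 k))
    (fun u => x 0 k *: (0 : W) + u 0 k *: F (delta_mx 0 k)).
  exact: (is_diff_scale (is_diff_coord x k) (is_diff_cst (F (delta_mx 0 k)) x)).
have := is_diff_sumr D; congr (is_diff_def _ _ _); apply/funext => u.
  by rewrite -linear_row.
by rewrite (linear_row lF u); apply: eq_bigr => k _; rewrite scaler0 add0r.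
Qed.

Lemma Ck_is_diff_lin V W k (A : set V) (F : V -> W) :
  (forall x, is_diff x F F) -> Ck k A F.
Proof.
move=> H; case: k => [|k].
  by move=> x _; have [fd _] := H x; exact: differentiable_continuous.
split=> [x _|v]; first by case: (H x).
rewrite (_ : (fun x => _) = fun=> F v); first exact: Ck_cst.
by apply/funext => x; case: (H x) => _ ->.
Qed.

Lemma Ck_linear_comp V W n k (A : set V) (F : V -> 'rV[R]_n -> W) (a : V -> 'rV[R]_n) :
  open A -> (forall x, A x -> linear (F x)) -> Ck k A a ->
  (forall j, Ck k A (F ^~ (delta_mx 0 j))) -> Ck k A (fun x => F x (a x)).
Proof.
move=> oA lF aC FC.
apply: (@Ck_ext _ _ _ _ _ (fun x => \sum_j a x 0 j *: F x (delta_mx 0 j))) => //.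
  by move=> x /set_mem Ax; rewrite -linear_row//; exact: lF.
apply: Ck_sum => // j; apply: Ck_scale => //; exact: Ck_coord.
Qed.

Lemma C0_bound V (A : set V) (g : V -> R) x0 : Ck 0 A g -> A x0 ->
  exists C, \forall x \near x0, `|g x| <= C.
Proof.
move=> gA Ax0; exists (`|g x0| + 1).
have /cvgrPdist_le /(_ _ ltr01) := gA _ Ax0; apply: filterS => x xP.
rewrite -(subrK (g x0) (g x)) addrC; apply: le_trans (ler_normD _ _) _.
by rewrite lerD2l distrC.
Qed.

(** Bounded partial derivatives bound the differential uniformly near [x0]; the mean value theorem
    on the segment from [y] to [x], which stays in a ball, does the rest. *)
Lemma C1_lipschitz n (A : set 'rV[R]_n) (g : 'rV[R]_n -> R) x0 :
  open A -> A x0 -> Ck 1 A g ->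
  exists C, \forall x & y \near x0, `|g x - g y| <= C * `|x - y|.
Proof.
move=> oA Ax0 [gd gC].
have xA : \forall x \near x0, A x by apply: open_nbhs_nbhs.
have [|||C C0 CP] := @linear_family_bound n _ unit (nbhs x0) _ (fun x _ v => 'd g x v) (fun _ _ => 1).
- by near=> x => _; exact: linearP.
- by [].
- move=> e; have [C CP] := C0_bound (gC e) Ax0; exists C.
  by apply: filterS CP => x xC _; rewrite mulr1.
have : \forall x \near x0, A x /\ forall v, `|'d g x v| <= C * `|v|.
  by apply: filterS2 xA CP => x Ax xP; split => // v; have := xP tt v; rewrite mulr1.
move=> /nbhs_ballP[e /= e0 eP]; exists C.
have xe : \forall x \near x0, ball x0 e x by apply: nbhsx_ballx.
near=> x y.
have : ball x0 e x by near: x.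
rewrite -ball_normE /= distrC => xb.
have : ball x0 e y by near: y.
rewrite -ball_normE /= distrC => yb.
have segP (s : R) : 0 <= s <= 1 -> ball x0 e (s *: (x - y) + y).
  move=> /andP[s0 s1]; rewrite -ball_normE /= distrC.
  rewrite (_ : s *: (x - y) + y - x0 = s *: (x - x0) + (1 - s) *: (y - x0)); last first.
    by apply/rowP => j; rewrite !mxE; ring.
  apply: le_lt_trans (ler_normD _ _) _; rewrite !normrZ !ger0_norm ?subr_ge0 //.
  (* The strict inequality is drawn from the summand of weight [s], hence the separate case
     [s = 0]. *)
  have [s0'|s0'] := eqVneq s 0; first by rewrite s0' mul0r subr0 mul1r add0r.
  rewrite (_ : e = s * e + (1 - s) * e); last by rewrite -mulrDl addrC subrK mul1r.
  apply: ltr_leD; first by rewrite ltr_pM2l // lt0r s0'.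
  by rewrite ler_wpM2l ?subr_ge0 // ltW.
have [|s /andP[s0 s1]] := @MVT_is_derive R (fun s => g (s *: (x - y) + y))
  (fun s => 'd g (s *: (x - y) + y) (x - y)) 0 1 ltr01.
  by move=> s s01; apply: is_derive_line; apply: gd; have [] := eP _ (segP s s01).
rewrite scale1r subrK scale0r add0r subr0 mulr1 => ->.
have [|_] := eP (s *: (x - y) + y); first by apply: segP; rewrite !ltW.
exact.
Unshelve. all: by end_near. Qed.

End Bounds.

(** * Inner products in finite dimension: Riesz representation and coercivity *)

Section InnerProducts.
Context {R : realType} {n : nat}.
Local Notation E := 'rV[R]_n.

(** The Gram matrix is invertible: a row vector in its left kernel pairs to 0 with every vector, in
    particular with itself, and positivity makes it 0. *)
Lemma riesz (b : E -> E -> R) (l : E -> R) :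
  (forall u, linear (b u)) -> (forall v, linear (b ^~ v)) ->
  (forall u, u != 0 -> 0 < b u u) -> linear l ->
  exists a, forall e, b a e = l e.
Proof.
move=> bl br bpos ll.
pose M : 'M[R]_n := \matrix_(j, k) b (delta_mx 0 j) (delta_mx 0 k).
have bM u k : (u *m M) 0 k = b u (delta_mx 0 k).
  rewrite mxE (linear_row (br _)); apply: eq_bigr => j _; by rewrite mxE.
have Mu : M \in unitmx.
  rewrite -row_free_unit -kermx_eq0; apply/rowV0P => v /sub_kermxP vM.
  apply/eqP; apply: contraT => /bpos.
  rewrite (linear_row (bl v)) big1 ?ltxx // => k _.
  by rewrite -bM vM mxE scaler0.
exists ((\row_k l (delta_mx 0 k)) *m invmx M) => e.
rewrite (linear_row (bl _)) (linear_row ll); apply: eq_bigr => k _.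
by rewrite -bM mulmxKV // mxE.
Qed.

Lemma posdef_coercive (b : E -> E -> R) :
  (forall u, linear (b u)) -> (forall v, linear (b ^~ v)) ->
  (forall u, u != 0 -> 0 < b u u) ->
  exists2 l : R, 0 < l & forall v, l * `|v| ^+ 2 <= b v v.
Proof.
move=> bl br bpos.
have bZ a v : b (a *: v) (a *: v) = a ^+ 2 * b v v.
  by rewrite (linear_homog a v (bl (a *: v))) (linear_homog a v (br v)) mulrA.
pose S : set E := [set v | `|v| = 1].
(* The unit sphere is empty only when every vector is 0, that is in dimension 0; otherwise [l] is
   the minimum of [b v v] on this compact set. *)
have [[v0 Sv0]|nS] := pselect (S !=set0); last first.
  exists 1 => // v; have [->|v0] := eqVneq v 0.
    have := bZ 0 0; rewrite scale0r => ->.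
    by rewrite normr0 expr0n mulr0 mul0r.
  exfalso; apply: nS; exists (`|v|^-1 *: v).
  by rewrite /S /= normrZ normfV normr_id mulVf // normr_eq0.
have bc : continuous (fun v => b v v).
  have H : Ck 0 setT (fun v => b v v).
    apply: (@Ck_linear_comp _ _ _ _ _ _ b id) => //; first exact: openT.
      by apply: Ck_is_diff_lin => x; exact: is_diff_id.
    by move=> j; apply: Ck_is_diff_lin => x; exact: linear_row_is_diff.
  by move=> v; exact: H.
have cS : compact S.
  apply: bounded_closed_compact.
    by exists 1; split=> // x x1 v /= ->; exact: ltW.
  rewrite (_ : S = (fun v : E => `|v|) @^-1` [set 1]); last by [].
  by apply: preimage_closed; [move=> v _; exact: norm_continuous|exact: closed_eq].
have [c cSS cmin] := @EVT_min_rV R n (fun v => b v v) S (ex_intro _ v0 Sv0) cS (continuous_subspaceT bc).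
move: cSS; rewrite inE => cSS.
exists (b c c).
  by apply: bpos; rewrite -normr_eq0 cSS oner_eq0.
move=> v; have [->|v_neq0] := eqVneq v 0.
  have := bZ 0 0; rewrite scale0r => ->.
  by rewrite normr0 expr0n mulr0 mul0r.
have nv : `|v| != 0 by rewrite normr_eq0.
have -> : v = `|v| *: (`|v|^-1 *: v) by rewrite scalerA divff // scale1r.
rewrite bZ normrZ normr_id.
have H : `| `|v|^-1 *: v| = 1 by rewrite normrZ normfV normr_id mulVf.
rewrite H mulr1 mulrC ler_wpM2l ?exprn_ge0 //; apply: cmin.
by rewrite inE.
Qed.

End InnerProducts.

Fact newton_rearrange (R : realFieldType) (A B C D F G : R) :
  A + B + C = D / 2 + F - G <-> B = D / 2 - A + F - C - G.
Proof. by split; lra. Qed.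

Fact linear_force_combination (R : realFieldType) (E : lmodType R) (F1 F2 F3 F4 F5 : E -> R) :
  scalar F1 -> scalar F2 -> scalar F3 -> scalar F4 -> scalar F5 ->
  scalar (fun e => F1 e / 2 - F2 e + F3 e - F4 e - F5 e).
Proof.
by move=> l1 l2 l3 l4 l5 a u v /=; rewrite l1 l2 l3 l4 l5; field.
Qed.

(** * Lagrangian systems in coordinates *)

Section Mechanical.
Context {R : realType} {n : nat}.
Local Notation E := 'rV[R]_n.

Lemma diff_param_linear (V W : normedModType R) (F : V -> E -> W) (x e : V) :
  (forall y, linear (F y)) -> (forall u, differentiable (F ^~ u) x) ->
  linear (fun u => 'd (F ^~ u) x e).
Proof.
move=> lF Fd a u v.
have -> : F ^~ (a *: u + v) = (fun y => a *: F y u + F y v).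
  by apply/funext => y; exact: lF.
have := is_diffD (is_diffZ a (differentiableP (Fd u))) (differentiableP (Fd v)).
by move=> [_ ->].
Qed.

(** The Lagrangian is [r x u u / 2 + m x u - W x]. Linearity and symmetry are required at all
    points, even outside [Om], because the Leibniz rules above ask for linearity everywhere; charts
    provide it, as [chart_inv] is total and [tvec] is linear at every point. *)
Record mechanical (Om : set E) (r : E -> E -> E -> R) (m : E -> E -> R)
    (W : E -> R) : Prop := Mechanical {
  mech_open : open Om;
  mech_metric_linear : forall x u, linear (r x u);
  mech_metric_sym : forall x u v, r x u v = r x v u;
  mech_metric_pos : forall x, Om x -> forall u, u != 0 -> 0 < r x u u;
  mech_metric_C2 : forall u v, Ck 2 Om (fun x => r x u v);
  mech_form_linear : forall x, linear (m x);
  mech_form_C2 : forall u, Ck 2 Om (m ^~ u);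
  mech_potential_C2 : Ck 2 Om W
}.

Variables (Om : set E) (r : E -> E -> E -> R) (m : E -> E -> R) (W : E -> R).
Hypothesis mech : mechanical Om r m W.

Let oOm : open Om := mech_open mech.
Let rl := mech_metric_linear mech.
Let ml := mech_form_linear mech.

Lemma mech_metric_linear_l x v : linear (fun u => r x u v).
Proof.
move=> a u u' /=; rewrite (mech_metric_sym mech) rl; congr (_ *: _ + _);
  exact: (mech_metric_sym mech).
Qed.

Let rr := mech_metric_linear_l.

Lemma mech_metric_diff x u v : Om x -> differentiable (fun y => r y u v) x.
Proof. by move=> xO; have [+ _] := mech_metric_C2 mech u v; apply. Qed.

Lemma mech_form_diff x u : Om x -> differentiable (m ^~ u) x.
Proof. by move=> xO; have [+ _] := mech_form_C2 mech u; apply. Qed.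

Lemma mech_potential_diff x : Om x -> differentiable W x.
Proof. by move=> xO; have [+ _] := mech_potential_C2 mech; apply. Qed.

(* Newton's equation for [r/2 + m - W] reads [r x a e = force x u e] for all
   [e], with [u] the velocity and [a] the second derivative. *)
Definition force (x u e : E) : R :=
  'd (fun y => r y u u) x e / 2 - 'd (fun y => r y u e) x u
  + 'd (m ^~ u) x e - 'd (m ^~ e) x u - 'd W x e.

Lemma momentum_derive (c v : R -> E) (t : R) a e : Om (c t) ->
  is_derive t 1 c (v t) -> is_derive t 1 v a ->
  is_derive t 1 (fun s => r (c s) (v s) e + m (c s) e)
    ('d (fun y => r y (v t) e) (c t) (v t) + r (c t) a e + 'd (m ^~ e) (c t) (v t)).
Proof.
move=> cO /is_derive_diff Dc /is_derive_diff Dv.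
have D1 := is_diff_param_linear_comp (fun y => rr y e)
  (fun u => differentiableP (mech_metric_diff u e cO)) Dc Dv.
have D2 : is_diff t (fun s => m (c s) e) (fun h => 'd (m ^~ e) (c t) (h *: v t)).
  exact: (@is_diff_comp _ _ _ _ c _ (m ^~ e) _ t Dc (differentiableP (mech_form_diff e cO))).
have /is_diff_derive1 := is_diffD D1 D2.
by rewrite !fctE !scale1r.
Qed.

(** When the acceleration exists, the derivative of the momentum is already known from
    [momentum_derive]; uniqueness of derivatives turns the Euler-Lagrange condition into an equality
    of numbers. *)
Lemma EL_iff_force (c v : R -> E) (t : R) a e : Om (c t) ->
  is_derive t 1 c (v t) -> is_derive t 1 v a ->
  is_derive t 1 (fun s => r (c s) (v s) e + m (c s) e)
    ('d (fun y => r y (v t) (v t)) (c t) e / 2 + 'd (m ^~ (v t)) (c t) e - 'd W (c t) e)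
  <-> r (c t) a e = force (c t) (v t) e.
Proof.
move=> cO Dc Dv; have [Dd DE] := momentum_derive e cO Dc Dv; rewrite /force.
split=> [[_]|/newton_rearrange H]; first by rewrite DE => /newton_rearrange.
by split => //; rewrite DE.
Qed.

Lemma lagrangian_diff_velocity x u e w :
  'D_e (fun u => r x u u / 2 + m x u - w) u = r x u e + m x e.
Proof.
have Dq : is_diff u (fun y => r x y y) (fun h => r x h u + r x u h).
  exact: (@is_diff_param_linear_comp R E E R n (r x) id id u id id
    (fun v h => r x h v) (rl x) (fun v => linear_row_is_diff u (rr x v))
    (is_diff_id u) (is_diff_id u)).
have Dm : is_diff u (m x) (m x) by exact: linear_row_is_diff.
have D := is_diffB (is_diffD (is_diffZ (2^-1 : R) Dq) Dm) (is_diff_cst (w : R) u).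
have -> : (fun u => r x u u / 2 + m x u - w) =
    (2^-1 : R) *: (fun y => r x y y) + m x - cst w.
  by apply/funext => y; rewrite !fctE /= mulrC.
have [_ ->] := is_diff_derive e D.
rewrite !fctE subr0 [r x e u](mech_metric_sym mech) /=; congr (_ + _).
have H (y : R) : 2^-1 * (y + y) = y by field.
exact: H.
Qed.

Lemma lagrangian_diff_position x u e : Om x ->
  'D_e (fun x => r x u u / 2 + m x u - W x) x =
  'd (fun y => r y u u) x e / 2 + 'd (m ^~ u) x e - 'd W x e.
Proof.
move=> xO.
have D := is_diffB (is_diffD (is_diffZ (2^-1 : R)
  (differentiableP (mech_metric_diff u u xO)))
  (differentiableP (mech_form_diff u xO))) (differentiableP (mech_potential_diff xO)).
have -> : (fun x => r x u u / 2 + m x u - W x) =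
    (2^-1 : R) *: (fun y => r y u u) + (m ^~ u) - W.
  by apply/funext => y; rewrite !fctE /= mulrC.
have [_ ->] := is_diff_derive e D.
by rewrite !fctE mulrC.
Qed.

Lemma force_linear x u : Om x -> linear (force x u).
Proof.
move=> xO.
have L1 := diff_param_linear u (fun y => rl y u) (fun e => mech_metric_diff u e xO).
have L2 := diff_param_linear u ml (fun e => mech_form_diff e xO).
exact: (linear_force_combination (linearP ('d (fun y => r y u u) x)) L1
  (linearP ('d (m ^~ u) x)) L2 (linearP ('d W x))).
Qed.

(** Riesz representation at each point, glued by choice. Nothing is said about the dependence on
    [(x, u)], which is studied separately. *)
Lemma acceleration_exists : exists acc : E -> E -> E,
  forall x u, Om x -> forall e, r x (acc x u) e = force x u e.
Proof.
have H (z : E * E) : exists a, Om z.1 -> forall e, r z.1 a e = force z.1 z.2 e.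
  have [zO|nzO] := pselect (Om z.1); last by exists 0.
  have [a aP] := @riesz R n (r z.1) (force z.1 z.2) (rl _) (rr _)
    (mech_metric_pos mech zO) (force_linear z.2 zO).
  by exists a.
have /choice[acc accP] := H.
by exists (fun x u => acc (x, u)) => x u xO e; exact: (accP (x, u)).
Qed.

(** Position and velocity are concatenated into one row vector, the format in which the Picard
    theorem is stated. *)
Definition phase_domain : set 'rV[R]_(n + n) := [set z | Om (lsubmx z)].

Lemma phase_domain_open : open phase_domain.
Proof.
apply: (@open_comp _ _ (lsubmx : 'rV[R]_(n + n) -> E) Om) => // z _.
exact: continuous_lsubmx.
Qed.

Lemma lsubmx_is_diff (z : 'rV[R]_(n + n)) : is_diff z (lsubmx : _ -> E) (lsubmx : _ -> E).
Proof. by apply: linear_row_is_diff => a u v; exact: linearP. Qed.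

Lemma rsubmx_is_diff (z : 'rV[R]_(n + n)) : is_diff z (rsubmx : _ -> E) (rsubmx : _ -> E).
Proof. by apply: linear_row_is_diff => a u v; exact: linearP. Qed.

Lemma Ck_base k (W' : normedModType R) (g : E -> W') : Ck k Om g ->
  Ck k phase_domain (fun z => g (lsubmx z)).
Proof.
move=> gC; apply: (Ck_comp phase_domain_open _ _ gC) => //.
by apply: Ck_is_diff_lin; exact: lsubmx_is_diff.
Qed.

(** One of the two derivatives of the coefficients is spent in [force]. The velocity enters linearly
    or quadratically, so each such term is expanded on the basis, twice in the quadratic case, until
    only first derivatives of coefficients on fixed vectors remain. *)
Lemma force_C1 e : Ck 1 phase_domain (fun z => force (lsubmx z) (rsubmx z) e).
Proof.
have oP := phase_domain_open.
have rC : Ck 1 phase_domain (rsubmx : _ -> E).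
  by apply: Ck_is_diff_lin; exact: rsubmx_is_diff.
have T_C u v f : Ck 1 phase_domain (fun z => 'd (fun y => r y u v) (lsubmx z) f).
  by apply: (@Ck_base _ _ (fun x => 'd (fun y => r y u v) x f)); have [_] := mech_metric_C2 mech u v; apply.
have M_C u f : Ck 1 phase_domain (fun z => 'd (m ^~ u) (lsubmx z) f).
  by apply: (@Ck_base _ _ (fun x => 'd (m ^~ u) x f)); have [_] := mech_form_C2 mech u; apply.
have W_C f : Ck 1 phase_domain (fun z => 'd W (lsubmx z) f).
  by apply: (@Ck_base _ _ (fun x => 'd W x f)); have [_] := mech_potential_C2 mech; apply.
have C1 : Ck 1 phase_domain (fun z => 'd (fun y => r y (rsubmx z) (rsubmx z)) (lsubmx z) e).
  apply: (@Ck_linear_comp _ _ _ _ _ _ (fun z u => 'd (fun y => r y u (rsubmx z)) (lsubmx z) e) rsubmx oP _ rC _).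
    move=> z zO; apply: (diff_param_linear e (fun y => rr y (rsubmx z))) => u.
    exact: mech_metric_diff.
  move=> j.
  apply: (@Ck_linear_comp _ _ _ _ _ _ (fun z u => 'd (fun y => r y (delta_mx 0 j) u) (lsubmx z) e) rsubmx oP _ rC _).
    move=> z zO; apply: (diff_param_linear e (fun y => rl y (delta_mx 0 j))) => u.
    exact: mech_metric_diff.
  by move=> i; exact: T_C.
have C2 : Ck 1 phase_domain (fun z => 'd (fun y => r y (rsubmx z) e) (lsubmx z) (rsubmx z)).
  apply: (@Ck_linear_comp _ _ _ _ _ _ (fun z u => 'd (fun y => r y u e) (lsubmx z) (rsubmx z)) rsubmx oP _ rC _).
    move=> z zO; apply: (diff_param_linear (rsubmx z) (fun y => rr y e)) => u.
    exact: mech_metric_diff.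
  move=> j.
  apply: (@Ck_linear_comp _ _ _ _ _ _ (fun z u => 'd (fun y => r y (delta_mx 0 j) e) (lsubmx z) u) rsubmx oP _ rC _).
    by move=> z _; exact: linearP.
  by move=> i; exact: T_C.
have C3 : Ck 1 phase_domain (fun z => 'd (m ^~ (rsubmx z)) (lsubmx z) e).
  apply: (@Ck_linear_comp _ _ _ _ _ _ (fun z u => 'd (m ^~ u) (lsubmx z) e) rsubmx oP _ rC _).
    move=> z zO; apply: (diff_param_linear e ml) => u.
    exact: mech_form_diff.
  by move=> i; exact: M_C.
have C4 : Ck 1 phase_domain (fun z => 'd (m ^~ e) (lsubmx z) (rsubmx z)).
  apply: (@Ck_linear_comp _ _ _ _ _ _ (fun z u => 'd (m ^~ e) (lsubmx z) u) rsubmx oP _ rC _).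
    by move=> z _; exact: linearP.
  by move=> i; exact: M_C.
have CZ a (g : 'rV[R]_(n + n) -> R) : Ck 1 phase_domain g -> Ck 1 phase_domain (fun z => a * g z).
  by move=> gC; apply: (Ck_scale oP _ gC); exact: Ck_cst.
have := CkD oP (CkD oP (CkD oP (CkD oP (CZ 2^-1 _ C1) (CZ (-1) _ C2)) C3) (CZ (-1) _ C4)) (CZ (-1) _ (W_C e)).
have E1 (A B C D F : R) : 2^-1 * A + -1 * B + C + -1 * D + -1 * F =
  A / 2 - B + C - D - F by field.
by congr (Ck _ _ _); apply/funext => z; exact: E1.
Qed.

End Mechanical.

Lemma linear_sub (R : pzRingType) (U W : lmodType R) (f g : U -> W) :
  linear f -> linear g -> linear (fun e => f e - g e).
Proof. by move=> lf lg a u v /=; rewrite lf lg scalerBr opprD addrACA. Qed.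

(** * Local existence for Newton's equation in coordinates *)

Section LocalFlow.
Context {R : realType} {n : nat}.
Local Notation E := 'rV[R]_n.

Lemma near2_ball (V : normedModType R) (x0 : V) (P : V -> V -> Prop) :
  (\forall x & y \near x0, P x y) ->
  exists2 e : R, 0 < e & forall x y, `|x - x0| < e -> `|y - x0| < e -> P x y.
Proof.
move=> [[A B] /= [/nbhs_ballP[a /= a0 aP] /nbhs_ballP[b /= b0 bP]] AB].
exists (Num.min a b); first by rewrite lt_min a0.
move=> x y; rewrite !lt_min => /andP[xa _] /andP[_ yb].
by apply: (AB (x, y)); split; [apply: aP|apply: bP]; rewrite -ball_normE /= distrC.
Qed.

Lemma near_ball (V : normedModType R) (x0 : V) (P : V -> Prop) :
  (\forall x \near x0, P x) ->
  exists2 e : R, 0 < e & forall x, `|x - x0| < e -> P x.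
Proof.
move=> /nbhs_ballP[a /= a0 aP]; exists a => // x xa.
by apply: aP; rewrite -ball_normE /= distrC.
Qed.

Lemma norm_lsubmx (z : 'rV[R]_(n + n)) : `|lsubmx z| <= `|z|.
Proof. by apply/row_norm_le => // k; rewrite mxE; exact: coord_le_norm. Qed.

Lemma norm_rsubmx (z : 'rV[R]_(n + n)) : `|rsubmx z| <= `|z|.
Proof. by apply/row_norm_le => // k; rewrite mxE; exact: coord_le_norm. Qed.

Lemma norm_row_mx (u v : E) (c : R) : `|u| <= c -> `|v| <= c -> `|row_mx u v| <= c.
Proof.
move=> uc vc; have c0 : 0 <= c by exact: le_trans uc.
apply/row_norm_le => // k; rewrite mxE.
by case: splitP => j _; [have := (row_norm_le u c0).1 uc j|have := (row_norm_le v c0).1 vc j].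
Qed.

Variables (Om : set E) (r : E -> E -> E -> R) (m : E -> E -> R) (W : E -> R).
Hypothesis mech : mechanical Om r m W.
Let oOm : open Om := mech_open mech.
Let rl := mech_metric_linear mech.
Let rr := mech_metric_linear_l mech.

Lemma metric_lipschitz x0 : Om x0 -> exists2 C : R, 0 < C &
  \forall x & y \near x0, forall u v, `|r x u v - r y u v| <= C * `|x - y| * `|u| * `|v|.
Proof.
move=> x0O.
have [||||C C0 CP] := @bilinear_family_bound R n (E * E) unit (nbhs (x0, x0)) _
  (fun s _ u v => r s.1 u v - r s.2 u v) (fun s _ => `|s.1 - s.2|).
- by apply: nearW => s a u; exact: linear_sub (rl _ _) (rl _ _).
- by apply: nearW => s a v; exact: linear_sub (rr _ _) (rr _ _).
- by [].
- move=> e f; have [C CP] := C1_lipschitz oOm x0O (Ck_pred (mech_metric_C2 mech e f)).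
  by exists C; apply: filterS CP => s sP _.
exists C => //; apply: filterS CP => s sP u v.
exact: sP.
Qed.

(** Half of the coercivity constant at [x0] is kept; the other half pays for the variation of the
    metric, at most [C * |x - x0| * |v|^2]. *)
Lemma metric_coercive x0 : Om x0 -> exists2 l : R, 0 < l &
  \forall x \near x0, forall v, l * `|v| ^+ 2 <= r x v v.
Proof.
move=> x0O.
have [l l0 lP] := posdef_coercive (rl x0) (rr x0) (mech_metric_pos mech x0O).
have [C C0 /near2_ball[e e0 eP]] := metric_lipschitz x0O.
exists (l / 2); first by rewrite divr_gt0.
apply/nbhs_ballP; exists (Num.min e (l / 2 / C)).
  by rewrite /= lt_min e0 !divr_gt0.
move=> x; rewrite -ball_normE /= distrC lt_min => /andP[xe xl] v.
have := eP x x0 xe _ v v; rewrite subrr normr0 => /(_ e0).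
rewrite ler_norml => /andP[+ _]; rewrite -mulrA -expr2.
have H : C * `|x - x0| * `|v| ^+ 2 <= l / 2 * `|v| ^+ 2.
  rewrite ler_wpM2r ?exprn_ge0 //.
  by rewrite mulrC -ler_pdivlMr // ltW.
have H2 := lP v.
move: H H2; set X := `|v| ^+ 2; set A := C * _ * X => H H2 H3.
have -> : l / 2 * X = l * X - l / 2 * X by field.
move: H H2 H3; set Y := l / 2 * X; set Z := l * X; set r1 := r x v v; set r2 := r x0 v v.
by clear; lra.
Qed.

(* Coercivity of [r] replaces the inverse matrix: [l * |a - a'|^2] is at most
   [r x (a - a') (a - a')], which the equations for [a] and [a'] turn into a
   difference of forces plus a difference of metrics. *)
Lemma acceleration_lipschitz (acc : E -> E -> E) (x0 u0 : E) :
  (forall x u, Om x -> forall e, r x (acc x u) e = force r m W x u e) -> Om x0 ->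
  exists L rho : R, [/\ 0 < L, 0 < rho & forall z z' : 'rV[R]_(n + n),
    `|z - row_mx x0 u0| <= rho -> `|z' - row_mx x0 u0| <= rho ->
    Om (lsubmx z) /\
    `|acc (lsubmx z) (rsubmx z) - acc (lsubmx z') (rsubmx z')| <= L * `|z - z'|].
Proof.
move=> accP x0O.
set z0 := row_mx x0 u0.
have z0O : phase_domain Om z0 by rewrite /phase_domain /= row_mxKl.
have oP := phase_domain_open mech.
have [l l0 /near_ball[e1 e10 lP]] := metric_coercive x0O.
have [C3 C30 /near2_ball[e2 e20 C3P]] := metric_lipschitz x0O.
have /near_ball[e3 e30 e3P] : \forall z \near z0, phase_domain Om z by apply: open_nbhs_nbhs.
pose F z e := force r m W (lsubmx z) (rsubmx z) e.
have Flin z : phase_domain Om z -> linear (F z) by move=> zO; exact: (force_linear mech).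
have nO : \forall z \near z0, phase_domain Om z by apply: open_nbhs_nbhs.
have [|||C1 C10 C1P] := @linear_family_bound R n ('rV[R]_(n + n) * 'rV[R]_(n + n)) unit (nbhs (z0, z0)) _
  (fun s _ e => F s.1 e - F s.2 e) (fun s _ => `|s.1 - s.2|).
- have : \forall s \near (z0, z0), phase_domain Om s.1 /\ phase_domain Om s.2.
    by exists (phase_domain Om, phase_domain Om) => // -[].
  by apply: filterS => s [sO1 sO2] _; exact: linear_sub (Flin _ sO1) (Flin _ sO2).
- by [].
- move=> e; have [C CP] := C1_lipschitz oP z0O (force_C1 mech e).
  by exists C; apply: filterS CP => s sP _.
have /near2_ball[e4 e40 C1P'] : \forall z & z' \near z0, forall e, `|F z e - F z' e| <= C1 * `|z - z'| * `|e|.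
  by apply: filterS C1P => s sP e; exact: (sP tt).
have [|||C2 C20 /near_ball[e5 e50 C2P]] := @linear_family_bound R n ('rV[R]_(n + n)) unit (nbhs z0) _
  (fun z _ e => F z e) (fun _ _ => 1).
- by apply: filterS nO => z zO _; exact: Flin.
- by [].
- move=> e; have [C CP] := C0_bound (Ck_pred (force_C1 mech e)) z0O.
  by exists C; apply: filterS CP => s sP _; rewrite mulr1.
pose rho := Num.min (Num.min e1 e2) (Num.min e3 (Num.min e4 e5)) / 2.
have mn0 : 0 < Num.min (Num.min e1 e2) (Num.min e3 (Num.min e4 e5)).
  by rewrite !lt_min e10 e20 e30 e40.
have rho0 : 0 < rho by rewrite divr_gt0.
(* [C1] and [C3] are Lipschitz constants of the force and of the metric, [C2] bounds the force, and
   [C2 / l] bounds the acceleration. The halving in [rho] turns the closed ball into strict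
   inequalities. *)
exists ((C1 + C3 * (C2 / l)) / l), rho; split => //.
  by rewrite divr_gt0 // ltr_pwDl // !mulr_ge0 ?invr_ge0 // ltW.
have rhoP z : `|z - z0| <= rho -> [/\ `|lsubmx z - x0| < e1, `|lsubmx z - x0| < e2,
    `|z - z0| < e3, `|z - z0| < e4 & `|z - z0| < e5].
  move=> zr.
  have : `|z - z0| < Num.min (Num.min e1 e2) (Num.min e3 (Num.min e4 e5)).
    by apply: le_lt_trans zr _; rewrite ltr_pdivrMr // ltr_pMr // ltr1n.
  rewrite !lt_min => /andP[/andP[h1 h2] /andP[h3 /andP[h4 h5]]].
  have hl : `|lsubmx z - x0| <= `|z - z0|.
    have := norm_lsubmx (z - z0); rewrite linearB /=.
    by rewrite /z0 row_mxKl.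
  by split => //; exact: le_lt_trans hl _.
move=> z z' /rhoP[z1 z2 z3 z4 z5] /rhoP[z1' z2' z3' z4' z5'].
have zO := e3P _ z3; have zO' := e3P _ z3'; split => //.
set a := acc _ _; set a' := acc _ _; set d := a - a'.
have lB x v v' w : r x (v - v') w = r x v w - r x v' w.
  by have := rr x w (-1) v' v; rewrite /= !scaleN1r ![- _ + _]addrC.
(* Newton's equation tested on [a'] itself: [l * |a'|^2 <= r a' a' = F z' a' <= C2 * |a'|]. *)
have na' : `|a'| <= C2 / l.
  have [->|a'0] := eqVneq a' 0; first by rewrite normr0 divr_ge0 // ltW.
  have na0 : 0 < `|a'| by rewrite normr_gt0.
  rewrite ler_pdivlMr // mulrC -(ler_pM2r na0) -mulrA -expr2.
  apply: le_trans (lP _ z1' a') _; have -> : r (lsubmx z') a' a' = F z' a' by exact: accP.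
  apply: le_trans (ler_norm _) _; have := C2P _ z5' tt a'.
  by rewrite mulr1.
have [d0|d0] := eqVneq d 0.
  by rewrite d0 normr0 !mulr_ge0 ?invr_ge0 ?addr_ge0 ?mulr_ge0 ?invr_ge0 // ltW.
have nd0 : 0 < `|d| by rewrite normr_gt0.
rewrite mulrAC ler_pdivlMr // mulrC -(ler_pM2r nd0) -mulrA -expr2.
apply: le_trans (lP _ z1 d) _.
have -> : r (lsubmx z) d d = (F z d - F z' d) - (r (lsubmx z) a' d - r (lsubmx z') a' d).
  have Ea : r (lsubmx z) a d = F z d by exact: accP.
  have Ea' : r (lsubmx z') a' d = F z' d by exact: accP.
  rewrite {1}/d lB Ea Ea'; move: (F z d) (F z' d) (r (lsubmx z) a' d) => A B C.
  by rewrite opprB addrA subrK.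
apply: le_trans (ler_norm _) _; apply: le_trans (ler_normB _ _) _.
rewrite mulrDl mulrDl; apply: lerD; first exact: C1P'.
apply: le_trans (C3P _ _ z2 z2' a' d) _.
rewrite ler_wpM2r //.
have hl : `|lsubmx z - lsubmx z'| <= `|z - z'|.
  by have := norm_lsubmx (z - z'); rewrite linearB.
rewrite -[C3 * _ * _ in leLHS]mulrA -[C3 * _ * _ in leRHS]mulrA ler_wpM2l ?(ltW C30) //.
by rewrite [leRHS]mulrC; apply: ler_pM.
Qed.

Lemma mechanical_local_solution (x0 u0 : E) : Om x0 ->
  exists2 d : R, 0 < d & exists c v a : R -> E,
    [/\ c 0 = x0, v 0 = u0 & forall t : R, `|t| < d ->
      [/\ Om (c t), is_derive t 1 c (v t), is_derive t 1 v (a t),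
        {for t, continuous a} & forall e, r (c t) (a t) e = force r m W (c t) (v t) e]].
Proof.
move=> x0O; have [acc accP] := acceleration_exists mech.
have [L [rho [L0 rho0 accL]]] := acceleration_lipschitz u0 accP x0O.
pose G z := row_mx (rsubmx z) (acc (lsubmx z) (rsubmx z)).
(* In the max norm the position half of [G] has Lipschitz constant 1 and the velocity half has [L];
   [L + 1] dominates both. *)
have [||d d0 [z z00 zP]] := @picard R _ G (row_mx x0 u0) (L + 1) rho _ rho0 _.
- by rewrite addr_gt0.
- move=> z z' zr zr'; rewrite /G opp_row_mx add_row_mx; apply: norm_row_mx.
    rewrite -linearB; apply: le_trans (norm_rsubmx _) _.
    by rewrite mulrDl mul1r lerDr mulr_ge0 // ltW.
  apply: le_trans (accL _ _ zr zr').2 _.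
  by rewrite mulrDl mul1r lerDl.
exists d => //; exists (fun t => lsubmx (z t)), (fun t => rsubmx (z t)),
  (fun t => acc (lsubmx (z t)) (rsubmx (z t))).
split; [by rewrite z00 row_mxKl|by rewrite z00 row_mxKr|].
move=> t td; have [zr zD] := zP t td.
have [zO _] := accL _ _ (ltW zr) (ltW zr).
have Dz := is_derive_diff zD.
split => //.
- have /is_diff_derive1 := @is_diff_comp _ _ _ _ _ _ _ _ t Dz (lsubmx_is_diff (z t)).
  by rewrite /= scale1r /G row_mxKl.
- have /is_diff_derive1 := @is_diff_comp _ _ _ _ _ _ _ _ t Dz (rsubmx_is_diff (z t)).
  by rewrite /= scale1r /G row_mxKr.
(* The acceleration is continuous along [z] because [acc] is Lipschitz; this is what makes the curve
   of class C^2. *)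
- apply/cvgrPdist_lt => e e0.
  have zc := is_derive_continuous zD.
  have eL : 0 < e / L by rewrite divr_gt0.
  have N1 : \forall s \near t, `|z t - z s| < e / L by have /cvgrPdist_lt := zc; apply.
  have N2 : \forall s \near t, `|s| < d.
    have /cvgr_lt : (fun s : R => `|s|) @ t --> `|t| by apply: norm_continuous.
    exact.
  apply: filterS2 N1 N2 => s s1 s2; have [zsr _] := zP s s2.
  apply: le_lt_trans (accL _ _ (ltW zr) (ltW zsr)).2 _.
  by rewrite mulrC -ltr_pdivlMr.
- exact: accP.
Qed.

End LocalFlow.

(** * Invariance of the Euler-Lagrange equations under changes of coordinates *)

Section ChangeOfCoordinates.
Context {R : realType} {n : nat}.
Local Notation E := 'rV[R]_n.

Fact half_add (R' : realFieldType) (A C D F G J : R') : C = D ->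
  (A + D + C) / 2 + (F + G) - J = A / 2 + F - J + (C + G).
Proof. by move=> ->; field. Qed.

Lemma is_diff_half_add_sub (V : normedModType R) (f g h df dg dh : V -> R) (y : V) :
  is_diff y f df -> is_diff y g dg -> is_diff y h dh ->
  is_diff y (fun y => f y / 2 + g y - h y) (fun w => df w / 2 + dg w - dh w).
Proof.
move=> fD gD hD; have := is_diffB (is_diffD (is_diffZ (2^-1 : R) fD) gD) hD.
congr (is_diff_def _ _ _); apply/funext => z; rewrite !fctE; congr (_ + _ - _);
  exact: mulrC.
Qed.

Lemma is_diff_diff (V W : normedModType R) (B : set V) (S : V -> W) y u :
  Ck 2 B S -> B y -> is_diff y (fun y => 'd S y u) ('d (fun y => 'd S y u) y).
Proof. by move=> [_ /(_ u)[+ _]] By; move=> /(_ y By) /differentiableP. Qed.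

Variables (Om : set E) (r : E -> E -> E -> R) (m : E -> E -> R) (W : E -> R).
Hypothesis mech : mechanical Om r m W.
Let rl := mech_metric_linear mech.
Let rr := mech_metric_linear_l mech.
Let ml := mech_form_linear mech.

Lemma form_pullback_diff (B : set E) (S : E -> E) (y u : E) :
  Ck 2 B S -> B y -> Om (S y) ->
  is_diff y (fun y => m (S y) ('d S y u))
    (fun w => 'd (m ^~ ('d S y u)) (S y) ('d S y w) + m (S y) ('d (fun y => 'd S y u) y w)).
Proof.
move=> SC By SO.
exact: (is_diff_param_linear_comp ml
  (fun e => differentiableP (mech_form_diff mech e SO)) (Ck_is_diff SC By) (is_diff_diff u SC By)).
Qed.

Lemma metric_pullback_diff (B : set E) (S : E -> E) (y u : E) :
  Ck 2 B S -> B y -> Om (S y) ->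
  is_diff y (fun y => r (S y) ('d S y u) ('d S y u))
    (fun w => 'd (fun x => r x ('d S y u) ('d S y u)) (S y) ('d S y w) +
      r (S y) ('d (fun y => 'd S y u) y w) ('d S y u) +
      r (S y) ('d S y u) ('d (fun y => 'd S y u) y w)).
Proof.
move=> SC By SO.
have D1 e : is_diff y (fun y => r (S y) ('d S y u) e)
    (fun w => 'd (fun x => r x ('d S y u) e) (S y) ('d S y w) + r (S y) ('d (fun y => 'd S y u) y w) e).
  exact: (is_diff_param_linear_comp (fun x => rr x e)
    (fun f => differentiableP (mech_metric_diff mech f e SO)) (Ck_is_diff SC By) (is_diff_diff u SC By)).
exact: (@is_diff_param_linear_comp R E E R n (fun y => r (S y) ('d S y u)) id
  (fun y => 'd S y u) y id _ _ (fun z => rl _ _) D1 (is_diff_id y) (is_diff_diff u SC By)).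
Qed.

Lemma lagrangian_pullback_derive (B : set E) (S : E -> E) (y u w : E) :
  Ck 2 B S -> B y -> Om (S y) ->
  let b' := 'd (fun y => 'd S y u) y w in
  'D_w (fun y => r (S y) ('d S y u) ('d S y u) / 2 + m (S y) ('d S y u) - W (S y)) y =
  'd (fun x => r x ('d S y u) ('d S y u)) (S y) ('d S y w) / 2
  + 'd (m ^~ ('d S y u)) (S y) ('d S y w) - 'd W (S y) ('d S y w)
  + (r (S y) ('d S y u) b' + m (S y) b').
Proof.
move=> SC By SO b'.
have DW : is_diff y (W \o S) ('d W (S y) \o 'd S y).
  exact: (is_diff_comp (Ck_is_diff SC By) (differentiableP (mech_potential_diff mech SO))).
have D := is_diff_half_add_sub (metric_pullback_diff u SC By SO)
  (form_pullback_diff u SC By SO) DW.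
have [_ ->] := is_diff_derive w D.
apply: half_add.
exact: (mech_metric_sym mech).
Qed.

(* The second derivatives of [S] appear as [D_v0 (dS w)] on the left and as
   [D_w (dS v0)] on the right; Schwarz's theorem makes them cancel. *)
Lemma EL_change_coordinates (B : set E) (S : E -> E) (d vc : R -> E) (v0 : E) (t : R) (w : E) :
  open B -> Ck 2 B S -> B (d t) -> Om (S (d t)) -> is_derive t 1 d v0 ->
  vc t = 'd S (d t) v0 ->
  (forall e, is_derive t 1 (fun s => r (S (d s)) (vc s) e + m (S (d s)) e)
    ('d (fun y => r y (vc t) (vc t)) (S (d t)) e / 2
     + 'd (m ^~ (vc t)) (S (d t)) e - 'd W (S (d t)) e)) ->
  is_derive t 1 (fun s => r (S (d s)) (vc s) ('d S (d s) w) + m (S (d s)) ('d S (d s) w))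
    ('D_w (fun y => r (S y) ('d S y v0) ('d S y v0) / 2 + m (S y) ('d S y v0) - W (S y)) (d t)).
Proof.
move=> oB SC Bd SO /is_derive_diff Dd vcE EL.
rewrite (lagrangian_pullback_derive v0 w SC Bd SO).
have Db := is_diff_comp Dd (is_diff_diff w SC Bd).
(* The momentum is a covector, paired here with the moving vector ['d S (d s) w]; the Leibniz rule
   leads back to fixed test vectors, for which the equation is the hypothesis [EL]. *)
have pl s : linear (fun e => r (S (d s)) (vc s) e + m (S (d s)) e).
  move=> a e e' /=; rewrite rl ml scalerDr addrACA //.
have DD := @is_diff_param_linear_comp R R R R n
  (fun s e => r (S (d s)) (vc s) e + m (S (d s)) e) id _ t id _ _ pl
  (fun e => is_derive_diff (EL e)) (is_diff_id t) Db.
have [D1 D2] := is_diff_derive1 DD; split; first exact: D1.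
rewrite D2 /= !scale1r vcE; congr (_ + _).
have cg (x y : E) : x = y -> r (S (d t)) ('d S (d t) v0) x + m (S (d t)) x =
  r (S (d t)) ('d S (d t) v0) y + m (S (d t)) y by move=> ->.
by apply: cg; exact: diff2_sym_row SC.
Qed.

End ChangeOfCoordinates.

(** * Lagrangian systems on a manifold *)

Section Charts.
Context {R : realType} {n : nat} (M : smoothManifold R n).
Local Notation E := 'rV[R]_n.
Local Notation I := (chart_index M).
Implicit Types (i j : I) (x : M) (u v : E).

Definition chart_image i (B : set M) : set E := chart i @` (chart_dom i `&` B).
Definition transition i j : E -> E := chart j \o chart_inv i.

Lemma chart_image_preimage i (B : set M) :
  chart_image i B = chart i @` chart_dom i `&` chart_inv i @^-1` B.
Proof.
apply/seteqP; split=> [_ [x [xi Bx] <-]|_ [[x xi <-]] /=].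
  by split; [exists x|rewrite /= chartK].
by rewrite chartK // => Bx; exists x.
Qed.

Lemma chart_image_openB i (B : set M) : open B -> open (chart_image i B).
Proof.
move=> oB; rewrite openE => _ [x [xi Bx] <-].
have N1 : nbhs (chart i x) (chart i @` chart_dom i).
  by apply: open_nbhs_nbhs; split; [exact: chart_image_open|exists x].
have N2 : nbhs (chart i x) (chart_inv i @^-1` B).
  by apply: (chart_inv_continuous xi); rewrite chartK //; apply: open_nbhs_nbhs.
by rewrite /interior chart_image_preimage; apply: filterI.
Qed.

Lemma tvec_linear i x : linear (tvec i x).
Proof.
move=> a u v; apply: val_inj; apply/funext => j /=.
rewrite /tvec_fun !fctE /=; case: asboolP => _; last by rewrite scaler0 addr0.
by rewrite /transition_diff linearP.
Qed.

Lemma tvec_coordE i j x u : chart_dom i x -> chart_dom j x ->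
  tvec i x u j = transition_diff i j x u.
Proof. by move=> xi xj; rewrite /= /tvec_fun; case: asboolP => // -[]. Qed.

Lemma tvecK i x (w : tangent x) : chart_dom i x -> tvec i x (w i) = w.
Proof.
move=> xi; have /asboolP[w1 w2] := valP w.
apply: val_inj; apply/funext => j /=; rewrite /tvec_fun.
case: asboolP => [[_ xj]|nij]; first by rewrite -w1.
by rewrite w2 // => xj; apply: nij.
Qed.

Lemma tvec_coord i x u : chart_dom i x -> tvec i x u i = u.
Proof.
move=> xi; rewrite tvec_coordE // /transition_diff.
have oi : open (chart i @` chart_dom i) by exact: chart_image_open.
have ii : (chart i @` chart_dom i) (chart i x) by exists x.
have H : {in chart i @` chart_dom i, id =1 chart i \o chart_inv i}.
  by move=> _ /set_mem[y yi <-] /=; rewrite chartK.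
by have [_ ->] := is_diff_open oi ii H (is_diff_id _).
Qed.

Lemma tvec_change i j x u : chart_dom i x -> chart_dom j x ->
  tvec j x u = tvec i x (transition_diff j i x u).
Proof. by move=> xi xj; rewrite -[LHS](tvecK _ xi) tvec_coordE. Qed.

Lemma tvec_neq0 i x u : chart_dom i x -> u != 0 -> tvec i x u != 0.
Proof.
move=> xi; apply: contra_neq => u0; rewrite -(tvec_coord u xi) u0 //.
Qed.

Lemma local_rep_at (F : forall x : M, tangent x -> R) i x u : chart_dom i x ->
  local_rep F i (chart i x) u = F x (tvec i x u).
Proof. by move=> xi; rewrite /local_rep chartK. Qed.

Lemma local_rep_change (F : forall x : M, tangent x -> R) i j y u :
  chart_image j (chart_dom i) y ->
  local_rep F j y u = local_rep F i (transition j i y) ('d (transition j i) y u).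
Proof.
move=> [x [xj xi] <-]; rewrite local_rep_at // (tvec_change _ xi xj).
by rewrite /transition /= chartK // local_rep_at.
Qed.

Lemma transition_C i j k : Ck k (chart_image i (chart_dom j)) (transition i j).
Proof. exact: transition_smooth. Qed.

(** [dfun] is computed in the chosen chart [chart_at x]; the chain rule through the transition map,
    which also relates the coordinates of [w], frees it from that choice. *)
Lemma dfun_chart (V : set M) (f : M -> R) i x (w : tangent x) :
  open V -> V x -> Ck_fun 1 V f -> chart_dom i x ->
  dfun f w = 'd (f \o chart_inv i) (chart i x) (w i).
Proof.
move=> oV Vx fC xi; rewrite /dfun.
set j := chart_at x; have xj : chart_dom j x := chart_atP x.
have /asboolP[w1 _] := valP w.
have -> : w i = transition_diff j i x (w j) := w1 j i xj xi.
have E1 : (chart i \o chart_inv j) (chart j x) = chart i x by rewrite /= chartK.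
have D : is_diff ((chart i \o chart_inv j) (chart j x)) (f \o chart_inv i)
    ('d (f \o chart_inv i) (chart i x)).
  by rewrite E1; apply: (Ck_is_diff (fC i)); exists x.
have DT := differentiableP (transition_differentiable xj xi).
have oO : open (chart_image j (chart_dom i)).
  exact/chart_image_openB/chart_dom_open.
have xO : chart_image j (chart_dom i) (chart j x) by exists x.
have fE : {in chart_image j (chart_dom i),
    (f \o chart_inv i) \o (chart i \o chart_inv j) =1 f \o chart_inv j}.
  by move=> _ /set_mem[y [yj yi] <-] /=; rewrite !chartK.
have [_ DE] := is_diff_open oO xO fE (is_diff_comp DT D).
exact: (congr1 (@^~ (w j)) DE).
Qed.

End Charts.

(** * The Lagrangian data and the Euler-Lagrange equations in charts *)

Section LagrangianInCharts.
Context {R : realType} {n : nat} (N : smoothManifold R n).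
Local Notation E := 'rV[R]_n.
Variables (Q mu : forall x : N, tangent x -> R) (U : N -> R)
  (rho : forall x : N, tangent x -> tangent x -> R).
Hypothesis Q_C2 : Ck_form 2 Q.
Hypothesis mu_form : one_form mu.
Hypothesis mu_C2 : Ck_form 2 mu.
Hypothesis U_C2 : Ck_fun 2 setT U.
Hypothesis rho_metric : riemannian_metric rho.
Hypothesis Q_rho : forall x (v : tangent x), Q v = tnorm rho v ^+ 2 / 2.

Definition local_metric (i : chart_index N) (xi u v : E) : R :=
  rho (tvec i (chart_inv i xi) u) (tvec i (chart_inv i xi) v).

Lemma rho_ge0 x (v : tangent x) : 0 <= rho v v.
Proof.
have [rl _ rp] := rho_metric x; have [->|v0] := eqVneq v 0; last by rewrite ltW // rp.
have := rl 0 (-1) 0 0; rewrite scaler0 addr0.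
by rewrite mulN1r addNr => ->.
Qed.

Lemma Q_half_rho x (v : tangent x) : Q v = rho v v / 2.
Proof. by rewrite Q_rho /tnorm sqr_sqrtr // rho_ge0. Qed.

(** Regularity is assumed of [Q]; polarization passes it on to the coefficients of the metric. *)
Lemma rho_polarization x (u v : tangent x) : rho u v = Q (u + v) - Q u - Q v.
Proof.
have [rl rs _] := rho_metric x.
have rD (a b c : tangent x) : rho a (b + c) = rho a b + rho a c.
  by have := rl a 1 b c; rewrite scale1r mul1r.
rewrite !Q_half_rho rD ![rho (u + v) _]rs !rD [rho v u]rs.
by move: (rho u u) (rho u v) (rho v v) => a b c; field.
Qed.

Lemma local_metric_polarization i xi u v : local_metric i xi u v =
  local_rep Q i xi (u + v) - local_rep Q i xi u - local_rep Q i xi v.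
Proof.
rewrite /local_metric rho_polarization /local_rep.
by have := tvec_linear i (chart_inv i xi) 1 u v; rewrite !scale1r => ->.
Qed.

Lemma chart_image_full i : chart_image i [set: N] = chart i @` chart_dom i.
Proof. by rewrite /chart_image setIT. Qed.

Lemma mechanical_chart i : mechanical (chart i @` chart_dom i)
  (local_metric i) (local_rep mu i) (U \o chart_inv i).
Proof.
have oO : open (chart i @` chart_dom i) by exact: chart_image_open.
split => //.
- move=> xi u a v w; rewrite /local_metric tvec_linear.
  by have [rl _ _] := rho_metric (chart_inv i xi); exact: rl.
- by move=> xi u v; have [_ rs _] := rho_metric (chart_inv i xi); exact: rs.
- move=> _ [x xi <-] u u0; rewrite /local_metric chartK //.
  by have [_ _] := rho_metric x; apply; exact: tvec_neq0.
- move=> u v.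
  have H : Ck 2 (chart i @` chart_dom i) (fun xi => local_rep Q i xi (u + v) +
      (-1 *: local_rep Q i xi u + -1 *: local_rep Q i xi v)).
    by apply: CkD => //; apply: CkD => //; apply: Ck_scale => //; exact: Ck_cst.
  apply: (Ck_ext oO _ H) => xi _.
  by rewrite local_metric_polarization !scaleN1r addrA.
- by move=> xi a u v; rewrite /local_rep tvec_linear; exact: mu_form.
- by rewrite -chart_image_full; exact: U_C2.
Qed.

Lemma local_metric_change i j y u v : chart_image j (chart_dom i) y ->
  local_metric j y u v =
  local_metric i (transition j i y) ('d (transition j i) y u) ('d (transition j i) y v).
Proof.
move=> [x [xj xi] <-]; rewrite /local_metric /transition /= !chartK //.
by rewrite !(tvec_change _ xi xj).
Qed.

(** Pulling [mu] back by the transition map produces a term with its second derivative; by Schwarz's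
    theorem this term is symmetric in [v] and [w] and disappears in the difference. *)
Lemma dform_chart i x (v w : tangent x) : chart_dom i x ->
  dform mu v w = 'd (fun xi => local_rep mu i xi (w i)) (chart i x) (v i) -
    'd (fun xi => local_rep mu i xi (v i)) (chart i x) (w i).
Proof.
move=> xi; rewrite /dform; set j := chart_at x; have xj : chart_dom j x := chart_atP x.
set B := chart_image j (chart_dom i); set S := transition j i; set y := chart j x.
have oB : open B by exact/chart_image_openB/chart_dom_open.
have By : B y by exists x.
have SC : Ck 2 B S by exact: transition_C.
have SyE : S y = chart i x by rewrite /S /transition /= chartK.
have SO : (chart i @` chart_dom i) (S y) by rewrite SyE; exists x.
have vE (z : tangent x) : z i = 'd S y (z j) by have /asboolP[+ _] := valP z; exact.
have D (u : E) : is_diff y (fun xi => local_rep mu j xi u)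
    (fun h => 'd (local_rep mu i ^~ ('d S y u)) (S y) ('d S y h) +
      local_rep mu i (S y) ('d (fun y => 'd S y u) y h)).
  apply: (is_diff_open oB By _ (form_pullback_diff (mechanical_chart i) u SC By SO)).
  by move=> z /set_mem Bz; rewrite [RHS](local_rep_change mu u Bz).
have DE u h : 'd (fun xi => local_rep mu j xi u) y h =
    'd (local_rep mu i ^~ ('d S y u)) (S y) ('d S y h) +
    local_rep mu i (S y) ('d (fun y => 'd S y u) y h).
  by have [_ DE] := D u; exact: (congr1 (@^~ h) DE).
have aux (a b c d A C : R) : A = a + b -> C = c + d -> b = d -> A - C = a - c.
  by move=> -> -> ->; rewrite opprD addrACA subrr addr0.
rewrite !vE -SyE; apply: aux (DE _ _) (DE _ _) _.
by apply: (congr1 (local_rep mu i (S y))); exact: diff2_sym_row SC.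
Qed.

Definition lagrangian (x : N) (v : tangent x) : R := Q v + mu v - U x.

Lemma local_rep_lagrangian i xi u : local_rep lagrangian i xi u =
  local_metric i xi u u / 2 + local_rep mu i xi u - (U \o chart_inv i) xi.
Proof. by rewrite /local_rep /lagrangian Q_half_rho. Qed.

Definition EL_chart (i : chart_index N) (g : R -> N) (t : R) : Prop :=
  forall e : E, let c := chart i \o g in
    is_derive t (1 : R)
      (fun s => 'D_e (fun u => local_rep lagrangian i (c s) u) ('D_1 c s))
      ('D_e (fun xi => local_rep lagrangian i xi ('D_1 c t)) (c t)).

Lemma momentumE i xi u e : 'D_e (fun u => local_rep lagrangian i xi u) u =
  local_metric i xi u e + local_rep mu i xi e.
Proof.
have -> : (fun u => local_rep lagrangian i xi u) = (fun u => local_metric i xi u u / 2 +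
    local_rep mu i xi u - (U \o chart_inv i) xi).
  by apply/funext => w; exact: local_rep_lagrangian.
exact: (lagrangian_diff_velocity (mechanical_chart i)).
Qed.

Lemma positionE i xi u e : (chart i @` chart_dom i) xi ->
  'D_e (fun xi => local_rep lagrangian i xi u) xi =
  'd (fun y => local_metric i y u u) xi e / 2 + 'd (local_rep mu i ^~ u) xi e
  - 'd (U \o chart_inv i) xi e.
Proof.
move=> xiO.
have -> : (fun xi => local_rep lagrangian i xi u) = (fun xi => local_metric i xi u u / 2 +
    local_rep mu i xi u - (U \o chart_inv i) xi).
  by apply/funext => w; exact: local_rep_lagrangian.
exact: (lagrangian_diff_position (mechanical_chart i)).
Qed.

Lemma EL_chartP i (g : R -> N) (t : R) : chart_dom i (g t) ->
  EL_chart i g t <-> forall e, let c := chart i \o g in let v := 'D_1 c in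
    is_derive t (1 : R) (fun s => local_metric i (c s) (v s) e + local_rep mu i (c s) e)
      ('d (fun y => local_metric i y (v t) (v t)) (c t) e / 2
       + 'd (local_rep mu i ^~ (v t)) (c t) e - 'd (U \o chart_inv i) (c t) e).
Proof.
move=> gi; rewrite /EL_chart /=.
have gO : (chart i @` chart_dom i) ((chart i \o g) t) by exists (g t).
have H e : is_derive t (1 : R)
      (fun s => 'D_e (fun u => local_rep lagrangian i ((chart i \o g) s) u) ('D_1 (chart i \o g) s))
      ('D_e (fun xi => local_rep lagrangian i xi ('D_1 (chart i \o g) t)) ((chart i \o g) t)) =
    is_derive t (1 : R) (fun s => local_metric i ((chart i \o g) s) ('D_1 (chart i \o g) s) e + local_rep mu i ((chart i \o g) s) e)
      ('d (fun y => local_metric i y ('D_1 (chart i \o g) t) ('D_1 (chart i \o g) t)) ((chart i \o g) t) e / 2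
       + 'd (local_rep mu i ^~ ('D_1 (chart i \o g) t)) ((chart i \o g) t) e - 'd (U \o chart_inv i) ((chart i \o g) t) e).
  congr (is_derive t 1 _ _).
    by apply/funext => s; exact: momentumE.
  exact: positionE.
by split => Hg e; have := Hg e; rewrite H.
Qed.

(** The momentum is differentiated at [t], so the transformation rule of velocities is needed on a
    whole neighborhood of [t]; hence the hypothesis on nearby [s]. *)
Lemma EL_chart_change i j (g : R -> N) (t : R) :
  chart_dom i (g t) -> chart_dom j (g t) -> {for t, continuous g} ->
  (\forall s \near t, is_derive s (1 : R) (chart i \o g) ('D_1 (chart i \o g) s)) ->
  EL_chart i g t -> EL_chart j g t.
Proof.
move=> gi gj gc ciD EL w.
set ci := chart i \o g; set cj := chart j \o g.
set B := chart_image j (chart_dom i); set S := transition j i; set T := transition i j.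
have oB : open B by exact/chart_image_openB/chart_dom_open.
have gij : \forall s \near t, chart_dom i (g s) /\ chart_dom j (g s).
  apply: filterI; apply: gc; apply: open_nbhs_nbhs; split => //; exact: chart_dom_open.
have Bcj : \forall s \near t, B (cj s).
  by apply: filterS gij => s [si sj]; exists (g s).
have ciE : \forall s \near t, S (cj s) = ci s.
  by apply: filterS gij => s [si sj]; rewrite /S /transition /cj /= chartK.
(* The forward transition [T] gives differentiability of [cj]; velocities are then compared through
   [S], the map by which the Lagrangian is pulled back. *)
have cjD : \forall s \near t, is_derive s (1 : R) cj ('D_1 cj s).
  move: (near_join gij) ciD; apply: filterS2 => s gs ciDs.
  have [si sj] := nbhs_singleton gs.
  have TD := Ck_is_diff (transition_C i j 1) (ex_intro2 _ _ (g s) (conj si sj) erefl).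
  have DT := is_diff_derive1 (is_diff_comp (is_derive_diff ciDs) TD).
  have [+ _] : is_derive s 1 cj ('d T (ci s) (1 *: 'D_1 ci s)).
    apply: (near_eq_is_derive _ DT).
    by apply: filterS gs => u [ui uj]; rewrite /= /transition /= chartK.
  exact: derivableP.
have velE : \forall s \near t, 'D_1 ci s = 'd S (cj s) ('D_1 cj s).
  move: (near_join ciE) cjD Bcj; apply: filterS3 => s cis cjs Bs.
  have DS := is_diff_derive1 (is_diff_comp (is_derive_diff cjs) (Ck_is_diff (transition_C j i 1) Bs)).
  have [_ ->] := near_eq_is_derive cis DS.
  by rewrite /= scale1r.
have cjt := nbhs_singleton cjD; have Bt := nbhs_singleton Bcj.
have cit := nbhs_singleton ciE; have velt := nbhs_singleton velE.
have SO : (chart i @` chart_dom i) (S (cj t)) by rewrite cit; exists (g t).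
have [ELi1 _] := EL_chartP gi.
have ELi := ELi1 EL.
have ELS e : is_derive t (1 : R) (fun s => local_metric i (S (cj s)) ('D_1 ci s) e + local_rep mu i (S (cj s)) e)
    ('d (fun y => local_metric i y ('D_1 ci t) ('D_1 ci t)) (S (cj t)) e / 2
       + 'd (local_rep mu i ^~ ('D_1 ci t)) (S (cj t)) e - 'd (U \o chart_inv i) (S (cj t)) e).
  rewrite cit; apply: near_eq_is_derive (ELi e).
  by apply: filterS ciE => s ->.
have K := EL_change_coordinates (mechanical_chart i) w oB (transition_C j i 2) Bt SO cjt velt ELS.
have RE : 'D_w (fun xi => local_rep lagrangian j xi ('D_1 cj t)) (cj t) =
    'D_w (fun y => local_metric i (S y) ('d S y ('D_1 cj t)) ('d S y ('D_1 cj t)) / 2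
      + local_rep mu i (S y) ('d S y ('D_1 cj t)) - (U \o chart_inv i) (S y)) (cj t).
  apply: near_eq_derive; have : nbhs (cj t) B by apply: open_nbhs_nbhs.
  apply: filterS => y By; rewrite (local_rep_change lagrangian _ By).
  exact: local_rep_lagrangian.
suff G : is_derive t (1 : R) (fun s => 'D_w (fun u => local_rep lagrangian j (cj s) u) ('D_1 cj s))
    ('D_w (fun xi => local_rep lagrangian j xi ('D_1 cj t)) (cj t)) by exact: G.
rewrite RE; apply: (near_eq_is_derive _ K).
move: velE Bcj; apply: filterS2 => s vs Bs; rewrite momentumE (local_metric_change _ _ Bs).
by rewrite (local_rep_change mu _ Bs) -/S -vs.
Qed.

End LagrangianInCharts.

(** * Gluing of solutions and maximal solutions *)

Section Curves.
Context {R : realType} {n : nat} (N : smoothManifold R n).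
Local Notation E := 'rV[R]_n.
Implicit Types (J : set R) (g : R -> N).

Lemma Ck_derive (V : normedModType R) k J (c v : R -> V) : open J ->
  (forall t, J t -> is_derive t (1 : R) c (v t)) -> Ck k J v -> Ck k.+1 J c.
Proof.
move=> oJ cD vC; split=> [t /cD /is_derive_diff[]//|h].
apply: (@Ck_ext _ _ _ _ _ (fun t => h *: v t)) => //.
  by move=> t /set_mem /cD /is_derive_diff[_ ->].
by apply: Ck_scale => //; exact: Ck_cst.
Qed.

Lemma open_curve_preimage J g (B : set N) : open J -> open B ->
  (forall t, J t -> {for t, continuous g}) -> open (J `&` g @^-1` B).
Proof.
move=> oJ oB gc; rewrite openE => t [Jt Bt]; apply: filterI.
  exact: open_nbhs_nbhs.
by apply: (gc t Jt); apply: open_nbhs_nbhs.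
Qed.

Lemma euler_lagrange_near (L : forall x : N, tangent x -> R) (g g' : R -> N) (t : R) :
  (\forall s \near t, g s = g' s) -> euler_lagrange_at L g t -> euler_lagrange_at L g' t.
Proof.
move=> gg' EL i g'i e.
have ggt : g t = g' t := nbhs_singleton gg'.
have cc : \forall s \near t, (chart i \o g) s = (chart i \o g') s.
  by apply: filterS gg' => s /= ->.
have dd : \forall s \near t, 'D_1 (chart i \o g) s = 'D_1 (chart i \o g') s.
  by apply: filterS (near_join cc) => s; exact: near_eq_derive.
have gi : chart_dom i (g t) by rewrite ggt.
have cct := nbhs_singleton cc; have ddt := nbhs_singleton dd.
have := EL i gi e => /=.
rewrite ddt [g t]ggt => K; apply: near_eq_is_derive K.
by move: cc dd; apply: filterS2 => s /= -> ->.
Qed.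

(** Only a preorder: two pairs that differ by values outside the common domain extend each other.
    Hence the preorder form of Zorn's lemma below. *)
Definition extends (Jg Jg' : set R * (R -> N)) : Prop :=
  Jg.1 `<=` Jg'.1 /\ forall t, Jg.1 t -> Jg'.2 t = Jg.2 t.

Lemma extends_trans a b c : extends a b -> extends b c -> extends a c.
Proof.
move=> [ab abE] [bc bcE]; split; first exact: subset_trans bc.
by move=> t at_; rewrite bcE ?abE //; exact: ab.
Qed.

(** Members of the family agree on common domains by the very definition of [extends], so gluing
    does not rest on uniqueness for the equation. Regularity and the equations are local in time;
    that the union is an interval uses comparability. *)
Lemma chain_union_solution (L : forall x : N, tangent x -> R)
    (A : set (set R * (R -> N))) :
  A !=set0 -> (forall s, A s -> solution L s.1 s.2) ->
  (forall s t, A s -> A t -> extends s t \/ extends t s) ->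
  exists2 s, solution L s.1 s.2 & forall a, A a -> extends a s.
Proof.
move=> [s0 As0] Asol Atot.
have /choice[g gP] : forall t, exists y, forall s, A s -> s.1 t -> y = s.2 t.
  move=> t.
  have [[s [As st]]|nex] := pselect (exists s, A s /\ s.1 t); last first.
    by exists (s0.2 t) => s As st; exfalso; apply: nex; exists s.
  exists (s.2 t) => s' As' s't.
  by have [[_ ->]|[_ ->]] := Atot _ _ As As'.
pose J := \bigcup_(s in A) s.1.
have gnear s t : A s -> s.1 t -> \forall u \near t, s.2 u = g u.
  move=> As st; have [_ os _ _ _] := Asol s As.
  have : nbhs t s.1 by apply: open_nbhs_nbhs.
  by apply: filterS => u su; rewrite (gP u s).
exists (J, g) => /=; last first.
  move=> s As; split=> [t st|t st] /=; first by exists s.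
  exact: gP.
split.
- move=> x y [s As sx] [s' As' s'y] z xzy.
  have [[ss' _]|[s's _]] := Atot _ _ As As'.
    have [int _ _ _ _] := Asol s' As'; exists s' => //.
    by apply: (int x y) => //; exact: ss'.
  have [int _ _ _ _] := Asol s As; exists s => //.
  by apply: (int x y) => //; exact: s's.
- by apply: bigcup_open => s /Asol[].
- by exists s0 => //; have [] := Asol _ As0.
- split=> [t [s As st]|i].
    have [_ _ _ [sc _] _] := Asol s As.
    rewrite /prop_for /continuous_at (gP t s) //; apply: cvg_trans (sc t st).
    apply: near_eq_cvg; exact: gnear.
  apply: Ck_local => t [[s As st] git].
  have [_ so _ [sc sC] _] := Asol s As.
  exists (s.1 `&` s.2 @^-1` chart_dom i), (chart i \o s.2); split => //.
  + by apply: open_curve_preimage => //; exact: chart_dom_open.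
  + by split => //=; rewrite -(gP t s).
  + by move=> u /set_mem[su _] /=; rewrite (gP u s).
- move=> t [s As st]; have [_ _ _ _ EL] := Asol s As.
  exact: euler_lagrange_near (gnear s t As st) (EL t st).
Qed.

Lemma maximal_extension (L : forall x : N, tangent x -> R) J0 g0 :
  solution L J0 g0 ->
  exists J g, [/\ maximal_solution L J g, J0 `<=` J & forall t, J0 t -> g t = g0 t].
Proof.
move=> sol0.
(* Zorn's lemma is applied to the extensions of [(J0, g0)] only. A maximal element there is maximal
   among all solutions, since whatever extends it also extends [(J0, g0)]. *)
pose T := {s : set R * (R -> N) | solution L s.1 s.2 /\ extends (J0, g0) s}.
have ext_refl s : extends s s by split.
have ext0 := ext_refl (J0, g0).
pose t0 : T := exist _ (J0, g0) (conj sol0 ext0).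
pose rT (s t : T) := `[< extends (sval s) (sval t) >].
have [|||[[J g] /= [sol ext]] maxT] := @ZL_preorder T t0 rT.
- by move=> t; apply/asboolP; exact: ext_refl.
- move=> a b c /asboolP ab /asboolP bc; apply/asboolP; exact: extends_trans bc.
- move=> A Atot.
  have [[a0 Aa0]|A0] := pselect (A !=set0); last first.
    by exists t0 => s As; exfalso; apply: A0; exists s.
  have [|||s ssol sext] := @chain_union_solution L [set sval a | a in A].
  + by exists (sval a0), a0.
  + by move=> _ [a Aa <-]; case: (svalP a).
  + by move=> _ _ [a Aa <-] [b Ab <-]; have [/asboolP ?|/asboolP ?] := Atot a b Aa Ab; [left|right].
  have e0 : extends (J0, g0) s.
    by apply: extends_trans (svalP a0).2 (sext _ _); exists a0.
  exists (exist _ s (conj ssol e0)) => a Aa; apply/asboolP => /=.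
  by apply: sext; exists a.
have [J0J gE] := ext.
exists J, g; split=> //.
split => // J' g' sol' JJ' gg'.
have e' : extends (J, g) (J', g') by split.
have e0' : extends (J0, g0) (J', g') by exact: extends_trans e'.
have /asboolP[] := maxT (exist _ (J', g') (conj sol' e0')) (introT (asboolP _) e').
by [].
Qed.

End Curves.

(** * Local solutions on the manifold with prescribed position and velocity *)

Section LocalSolution.
Context {R : realType} {n : nat} (N : smoothManifold R n).
Local Notation E := 'rV[R]_n.
Variables (Q mu : forall x : N, tangent x -> R) (U : N -> R)
  (rho : forall x : N, tangent x -> tangent x -> R).
Hypothesis Q_C2 : Ck_form 2 Q.
Hypothesis mu_form : one_form mu.
Hypothesis mu_C2 : Ck_form 2 mu.
Hypothesis U_C2 : Ck_fun 2 setT U.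
Hypothesis rho_metric : riemannian_metric rho.
Hypothesis Q_rho : forall x (v : tangent x), Q v = tnorm rho v ^+ 2 / 2.

Lemma local_solution i (x0 : N) (u0 : E) : chart_dom i x0 ->
  exists J g, [/\ solution (lagrangian Q mu U) J g, g 0 = x0 & 'D_1 (chart i \o g) 0 = u0].
Proof.
move=> x0i.
have mech := mechanical_chart Q_C2 mu_form mu_C2 U_C2 rho_metric Q_rho i.
have x0O : (chart i @` chart_dom i) (chart i x0) by exists x0.
have [d d0 [c [v [a [c0 v0 cva]]]]] := mechanical_local_solution mech u0 x0O.
pose J : set R := [set t | `|t| < d].
have oJ : open J.
  rewrite (_ : J = ball 0 d); first exact: ball_open.
  by apply/seteqP; split=> t; rewrite /J -ball_normE /= sub0r normrN.
pose g t := chart_inv i (c t).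
have gP t : J t -> chart_dom i (g t) /\ chart i (g t) = c t.
  by move=> /cva[[y yi yE] _ _ _ _]; rewrite /g -yE chartK.
have gc t : J t -> {for t, continuous g}.
  move=> Jt; have [[y yi yE] cD _ _ _] := cva t Jt.
  apply: continuous_comp; first exact: is_derive_continuous cD.
  by rewrite -yE; exact: chart_inv_continuous.
have vC : Ck 1 J v.
  apply: (@Ck_derive _ _ _ _ _ a) => // [t Jt|t Jt]; first by case: (cva t Jt).
  by case: (cva t Jt).
have cC : Ck 2 J c.
  by apply: (@Ck_derive _ _ _ _ _ v) => // t Jt; case: (cva t Jt).
have cnear t : J t -> \forall s \near t, c s = (chart i \o g) s.
  move=> Jt; have : nbhs t J by apply: open_nbhs_nbhs.
  by apply: filterS => s /gP[_ /= ->].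
have J0 : J 0 by rewrite /J /= normr0.
have gD t : J t -> is_derive t (1 : R) (chart i \o g) (v t).
  by move=> Jt; apply: near_eq_is_derive (cnear t Jt) _; case: (cva t Jt).
exists J, g; split.
- split => //.
  + move=> x y; rewrite /J /= !ltr_norml => /andP[x1 x2] /andP[y1 y2] z /andP[xz zy].
    by rewrite ltr_norml (lt_le_trans x1 xz) (le_lt_trans zy y2).
  + split => // j.
    have oA : open (J `&` g @^-1` chart_dom j).
      by apply: open_curve_preimage => //; exact: chart_dom_open.
    apply: (@Ck_ext _ _ _ 2 _ (transition i j \o c)); [exact: oA|by []|].
    apply: (@Ck_comp _ _ _ _ 2 _ (chart_image i (chart_dom j))); first exact: oA.
    * move=> t [Jt gj]; have [gi <-] := gP t Jt; by exists (g t).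
    * by apply: Ck_sub cC => t [].
    * exact: transition_C.
  + move=> t Jt.
    have [gi cE] := gP t Jt; have [cO cD vD _ aE] := cva t Jt.
    have Jn : nbhs t J by apply: open_nbhs_nbhs.
    have ELi : EL_chart Q mu U i g t.
      apply/(EL_chartP Q_C2 mu_form mu_C2 U_C2 rho_metric Q_rho gi) => e /=.
      have K := (EL_iff_force mech e cO cD vD).2 (aE e).
      have [_ vE] := gD t Jt.
      rewrite vE cE; apply: near_eq_is_derive K.
      apply: filterS Jn => s Js; have [_ ->] := gD s Js.
      by have [_ ->] := gP s Js.
    move=> j gj.
    apply: (EL_chart_change Q_C2 mu_form mu_C2 U_C2 rho_metric Q_rho gi gj (gc t Jt) _ ELi).
    apply: filterS Jn => s Js; have Ds := gD s Js.
    by have [Dd DE] := Ds; rewrite DE.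
- by rewrite /g c0 chartK.
- by have [_ ->] := gD 0 J0.
Qed.

End LocalSolution.

(** Newton's equation tested on the velocity: the two magnetic terms [F] cancel, and the derivative
    [D] of the metric is compensated by the acceleration terms [b] and [b']. *)
Fact energy_balance (R : realFieldType) (D F w b b' : R) :
  b = D / 2 - D + F - F - w -> b' = b -> (D + b + b') / 2 + w = 0.
Proof. by move=> -> ->; field. Qed.

(** The first group is the Riemannian Hessian on [(v, v)]: contracting the Christoffel symbols with
    the differential, written as [r X], gives [C - B / 2]. The second group is [dmu] on the gradient
    and the velocity. *)
Fact hessian_split (R : realFieldType) (A B C D F G : R) :
  A + (B / 2 - C + D - F - G) = (A + B / 2 - C) + (D - F) - G.
Proof. ring. Qed.

Fact quadratic_bound (R : realFieldType) (C1 C3 X l V B : R) :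
  0 < l -> 0 <= C1 -> 0 <= C3 -> 0 <= X -> X <= B -> 0 <= V ->
  C1 * V * V + C3 * X * V * V / 2 + C3 * V * V * X <=
  (C1 + 2 * C3 * B) / l * (l * V ^+ 2).
Proof.
move=> l0 C10 C30 X0 XB V0.
have -> : (C1 + 2 * C3 * B) / l * (l * V ^+ 2) = C1 * V ^+ 2 + 2 * (C3 * B * V ^+ 2).
  by field; rewrite gt_eqF.
have -> : C1 * V * V + C3 * X * V * V / 2 + C3 * V * V * X =
  C1 * V ^+ 2 + (3 / 2) * (C3 * X * V ^+ 2) by field.
have H : C3 * X * V ^+ 2 <= C3 * B * V ^+ 2.
  by rewrite ler_wpM2r ?exprn_ge0 // ler_wpM2l.
have H0 : 0 <= C3 * X * V ^+ 2 by rewrite !mulr_ge0 ?exprn_ge0.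
move: H H0; set x := C3 * X * _; set y := C3 * B * _; set z := C1 * _.
by clear; lra.
Qed.

(** Here [q] is the squared speed and [w] the potential. The product of square roots comes from the
    exponent 1/2 in the hypothesis on [dmu]; expanding the square of [sqrt w - sqrt q] bounds it by
    the energy. *)
Fact energy_bound (R : rcfType) (C K1 K2 q w : R) :
  0 <= C -> 0 <= K1 -> 0 <= K2 -> 0 <= q -> 0 <= w ->
  C * q + K2 * (Num.sqrt w * Num.sqrt q) + K1 * w <= (2 * C + K1 + 2 * K2) * (q / 2 + w).
Proof.
move=> C0 K10 K20 q0 w0.
have H : Num.sqrt w * Num.sqrt q <= q / 2 + w.
  rewrite -{2}(sqr_sqrtr q0) -{2}(sqr_sqrtr w0).
  have := sqr_ge0 (Num.sqrt w - Num.sqrt q).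
  have := sqr_ge0 (Num.sqrt w).
  rewrite sqrrB; move: (Num.sqrt w) (Num.sqrt q) => x y.
  rewrite -mulr_natr; move: (x ^+ 2) (y ^+ 2) (x * y) => a b c; clear; lra.
have s0 : 0 <= Num.sqrt w * Num.sqrt q by rewrite mulr_ge0 ?sqrtr_ge0.
have H2 : K2 * (Num.sqrt w * Num.sqrt q) <= K2 * (q / 2 + w) by rewrite ler_wpM2l.
have e1 : 0 <= C * q by rewrite mulr_ge0.
have e2 : 0 <= C * w by rewrite mulr_ge0.
have e3 : 0 <= K1 * q by rewrite mulr_ge0.
have e4 : 0 <= K1 * w by rewrite mulr_ge0.
have e5 : 0 <= K2 * q by rewrite mulr_ge0.
have e6 : 0 <= K2 * w by rewrite mulr_ge0.
have -> : (2 * C + K1 + 2 * K2) * (q / 2 + w) =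
  C * q + 2 * (C * w) + K1 * q / 2 + K1 * w + 2 * (K2 * (q / 2 + w)) by field.
have e7 : K2 * (q / 2 + w) = K2 * q / 2 + K2 * w by field.
move: H2 e1 e2 e3 e4 e5 e6 e7; set a1 := C * q; set a2 := C * w; set a3 := K1 * q;
  set a4 := K1 * w; set a5 := K2 * q; set a6 := K2 * w; set a7 := K2 * (_ + _);
  set a8 := K2 * (_ * _).
by clear; lra.
Qed.

(** * Instability *)

Section InstabilityEstimates.
Context {R : realType} {n : nat}.
Local Notation E := 'rV[R]_n.

Lemma linear_growth (phi psi dphi : R -> R) (e alpha beta C : R) :
  0 < e -> 0 < alpha -> 0 < beta -> 0 < C ->
  (forall t : R, 0 <= t -> is_derive t (1 : R) psi (phi t)) ->
  (forall t : R, 0 <= t -> is_derive t (1 : R) phi (dphi t)) ->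
  (forall t : R, 0 <= t -> `|dphi t| <= C * (e ^+ 2 * beta)) ->
  phi 0 = e * alpha ->
  exists2 t : R, 0 <= t & alpha ^+ 2 / (4 * C * beta) <= psi t - psi 0.
Proof.
move=> e0 a0 b0 C0 psiD phiD dphiB phi0.
(* The time at which the bound [C * (e ^+ 2 * beta) * T] on the variation of [phi] reaches half of
   [phi 0]; in the gain [e * alpha / 2 * T] the powers of [e] cancel. *)
pose T := alpha / (2 * C * beta * e).
have T0 : 0 < T by rewrite divr_gt0 // !mulr_gt0.
have phiT (t : R) : 0 <= t <= T -> e * alpha / 2 <= phi t.
  move=> /andP[t0 tT].
  have [->|tn0] := eqVneq t 0.
    by rewrite phi0 ler_pdivrMr // ler_peMr ?ler1n // ltW // mulr_gt0.
  have tp : 0 < t by rewrite lt0r tn0.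
  have [|s /andP[s0 st] sE] := @MVT_is_derive R phi dphi 0 t tp.
    by move=> x /andP[x0 _]; exact: phiD.
  have H1 : `|dphi s * t| <= C * (e ^+ 2 * beta) * T.
    rewrite normrM (ger0_norm t0); apply: ler_pM => //; exact/dphiB/ltW.
  have H2 : C * (e ^+ 2 * beta) * T = e * alpha / 2.
    by rewrite /T; field; rewrite !gt_eqF.
  move: sE H1; rewrite phi0 subr0 H2 ler_norml => sE /andP[H3 _].
  have -> : phi t = e * alpha + dphi s * t by rewrite -sE addrC subrK.
  move: H3; move: (dphi s * t) (e * alpha) => x y; clear; lra.
exists T; first exact: ltW.
have [|s /andP[s0 sT] ->] := @MVT_is_derive R psi phi 0 T T0.
  by move=> x /andP[x0 _]; exact: psiD.
rewrite subr0; apply: (@le_trans _ _ (e * alpha / 2 * T)).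
  rewrite le_eqVlt; apply/orP; left; apply/eqP.
  by rewrite /T; field; rewrite !gt_eqF.
by rewrite ler_wpM2r ?(ltW T0) // phiT // (ltW s0) (ltW sT).
Qed.

Variables (Om : set E) (r : E -> E -> E -> R) (m : E -> E -> R) (W : E -> R).
Hypothesis mech : mechanical Om r m W.
Let oOm : open Om := mech_open mech.
Let rl := mech_metric_linear mech.
Let rr := mech_metric_linear_l mech.

Lemma energy_conserved (c v : R -> E) (a : E) (t : R) : Om (c t) ->
  is_derive t (1 : R) c (v t) -> is_derive t (1 : R) v a ->
  (forall e, r (c t) a e = force r m W (c t) (v t) e) ->
  is_derive t (1 : R) (fun s => r (c s) (v s) (v s) / 2 + W (c s)) 0.
Proof.
move=> cO /is_derive_diff Dc /is_derive_diff Dv EL.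
have D1 e := is_diff_param_linear_comp (fun x => rr x e)
    (fun f => differentiableP (mech_metric_diff mech f e cO)) Dc Dv.
have D2 := @is_diff_param_linear_comp R R R R n (fun s => r (c s) (v s)) id v t id _ _
  (fun s => rl _ _) D1 (is_diff_id t) Dv.
have D3 := is_diff_comp Dc (differentiableP (mech_potential_diff mech cO)).
have D4 := is_diff_half_add_sub D2 D3 (is_diff_cst (0 : R) t).
have [D5 D6] := is_diff_derive1 D4.
have -> : (fun s => r (c s) (v s) (v s) / 2 + W (c s)) =
    (fun s => r (c s) (v s) (v s) / 2 + W (c s) - cst 0 s).
  by apply/funext => s; rewrite subr0.
split; first exact: D5.
rewrite D6 /= !scale1r subr0; apply: energy_balance (EL (v t)) _.
exact: (mech_metric_sym mech).
Qed.

Variables (OV : set E) (h : E -> R).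
Hypotheses (oOV : open OV) (OVOm : OV `<=` Om) (hC : Ck 2 OV h).

(* [X] is the gradient at the single point [c t]: it is never differentiated,
   because [fun s => 'd h (c s) (v s)] does not involve the metric. *)
Lemma gradient_momentum_derive (c v : R -> E) (a X : E) (t : R) : OV (c t) ->
  is_derive t (1 : R) c (v t) -> is_derive t (1 : R) v a ->
  (forall e, r (c t) a e = force r m W (c t) (v t) e) ->
  (forall e, r (c t) X e = 'd h (c t) e) ->
  is_derive t (1 : R) (fun s => 'd h (c s) (v s))
    ('d (fun y => 'd h y (v t)) (c t) (v t) + force r m W (c t) (v t) X).
Proof.
move=> cO /is_derive_diff Dc /is_derive_diff Dv EL XP.
have D := is_diff_param_linear_comp (fun x => linearP ('d h x))
  (fun u => is_diff_diff u hC cO) Dc Dv.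
have [D1 D2] := is_diff_derive1 D.
split; first exact: D1.
rewrite D2 !scale1r; congr (_ + _).
by rewrite -EL -XP; exact: (mech_metric_sym mech).
Qed.

Lemma hessian_bound (x0 : E) : OV x0 ->
  exists2 C : R, 0 < C & \forall x \near x0, forall X, (forall e, r x X e = 'd h x e) ->
    forall v, `|'d (fun y => 'd h y v) x v + 'd (fun y => r y v v) x X / 2
      - 'd (fun y => r y v X) x v| <= C * r x v v.
Proof.
move=> x0V; have x0O := OVOm x0V.
have nV : \forall x \near x0, OV x by apply: open_nbhs_nbhs.
have [l l0 lP] := metric_coercive mech x0O.
have [_ hCv] := hC.
have [||||C1 C10 C1P] := @bilinear_family_bound R n E unit (nbhs x0) _
  (fun x _ u v => 'd (fun y => 'd h y u) x v) (fun _ _ => 1).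
- by apply: nearW => x _ u; exact: linearP.
- apply: filterS nV => x xV _ v.
  apply: (diff_param_linear v (fun y => linearP ('d h y))) => u.
  by have [+ _] := hCv u; apply.
- by [].
- move=> e f; have [_ /(_ f) hCef] := hCv e.
  have [C CP] := C0_bound hCef x0V.
  by exists C; apply: filterS CP => x xP _; rewrite mulr1.
have [||||C3 C30 C3P] := @bilinear_family_bound R n E E (nbhs x0) _
  (fun x e u v => 'd (fun y => r y u v) x e) (fun _ e => `|e|).
- apply: filterS nV => x xV e u.
  apply: (diff_param_linear e (fun y => rl y u)) => w.
  exact: (mech_metric_diff mech _ _ (OVOm xV)).
- apply: filterS nV => x xV e v.
  apply: (diff_param_linear e (fun y => rr y v)) => w.
  exact: (mech_metric_diff mech _ _ (OVOm xV)).
- by [].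
- move=> u v.
  have [|||C C0 CP] := @linear_family_bound R n E unit (nbhs x0) _
    (fun x _ e => 'd (fun y => r y u v) x e) (fun _ _ => 1).
  + by apply: nearW => x _; exact: linearP.
  + by [].
  + move=> e; have [_ /(_ e) rCe] := mech_metric_C2 mech u v.
    have [C CP] := C0_bound (Ck_pred (k := 0) rCe) x0O.
    by exists C; apply: filterS CP => x xP _; rewrite mulr1.
  by exists C; apply: filterS CP => x xP e; have := xP tt e; rewrite mulr1.
have [|||Ch Ch0 ChP] := @linear_family_bound R n E unit (nbhs x0) _
  (fun x _ e => 'd h x e) (fun _ _ => 1).
- by apply: nearW => x _; exact: linearP.
- by [].
- move=> e; have [C CP] := C0_bound (Ck_pred (k := 0) (hCv e)) x0V.
  by exists C; apply: filterS CP => x xP _; rewrite mulr1.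
have K0 : 0 < (C1 + 2 * C3 * (Ch / l)) / l.
  by rewrite divr_gt0 // ltr_wpDr // !mulr_ge0 ?invr_ge0 // ltW.
exists ((C1 + 2 * C3 * (Ch / l)) / l); first exact: K0.
have FN : Filter (nbhs x0) by exact: nbhs_filter.
have H := @filterI _ _ FN _ _ lP (@filterI _ _ FN _ _ C1P (@filterI _ _ FN _ _ C3P ChP)).
apply: (@filterS _ _ FN _ _ _ H) => x [xl [x1 [x3 xh]]] X XP v.
have XB : `|X| <= Ch / l.
  have [->|X0] := eqVneq X 0; first by rewrite normr0 divr_ge0 // ltW.
  have nX0 : 0 < `|X| by rewrite normr_gt0.
  rewrite ler_pdivlMr // mulrC -(ler_pM2r nX0) -mulrA -expr2.
  apply: le_trans (xl X) _; rewrite XP.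
  apply: le_trans (ler_norm _) _.
  by have := xh tt X; rewrite mulr1.
apply: le_trans (ler_wpM2l _ (xl v)); last first.
  exact: ltW K0.
apply: le_trans (quadratic_bound l0 (ltW C10) (ltW C30) (normr_ge0 X) XB (normr_ge0 v)).
have B1 : `|'d (fun y => 'd h y v) x v| <= C1 * `|v| * `|v|.
  by have := x1 tt v v; rewrite mulr1.
have B2' := x3 X v v; have B3 := x3 v v X.
have B2 : `|'d (fun y => r y v v) x X / 2| <= C3 * `|X| * `|v| * `|v| / 2.
  by rewrite normrM [X in _ * X]ger0_norm ?invr_ge0 // ler_wpM2r ?invr_ge0.
apply: le_trans (ler_normB _ _) _; apply: lerD B3.
by apply: le_trans (ler_normD _ _) _; apply: lerD B1 B2.
Qed.

Lemma gradient_momentum_bound (C K1 K2 : R) (x X v : E) :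
  0 <= C -> 0 <= K1 -> 0 <= K2 -> 0 <= W x -> 0 <= r x v v ->
  `|'d (fun y => 'd h y v) x v + 'd (fun y => r y v v) x X / 2
      - 'd (fun y => r y v X) x v| <= C * r x v v ->
  `|'d W x X| <= K1 * W x ->
  `|'d (m ^~ v) x X - 'd (m ^~ X) x v| <= K2 * Num.sqrt (W x) * Num.sqrt (r x v v) ->
  `|'d (fun y => 'd h y v) x v + force r m W x v X| <=
    (2 * C + K1 + 2 * K2) * (r x v v / 2 + W x).
Proof.
move=> C0 K10 K20 W0 q0 H1 H2 H3.
rewrite /force hessian_split; apply: le_trans (energy_bound C0 K10 K20 q0 W0).
apply: le_trans (ler_normB _ _) _; apply: lerD H2.
apply: le_trans (ler_normD _ _) _; apply: lerD H1 _.
by rewrite mulrA.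
Qed.

End InstabilityEstimates.

Fact le_1D_sqr (R : realFieldType) (y : R) : y <= 1 + y ^+ 2.
Proof. by have := sqr_ge0 (y - 1); have := sqr_ge0 y; nra. Qed.

(** * Critical points, the gradient and the dual norm *)

Section Gradient.
Context {R : realType} {n : nat} (N : smoothManifold R n).
Local Notation E := 'rV[R]_n.
Variable rho : forall x : N, tangent x -> tangent x -> R.
Hypothesis rho_metric : riemannian_metric rho.

Lemma diff_at_min (V : normedModType R) (A : set V) (f : V -> R) (x e : V) :
  open A -> A x -> (forall y, A y -> differentiable f y) ->
  (forall y, A y -> f x <= f y) -> 'd f x e = 0.
Proof.
move=> oA Ax fd fmin.
have xA : \forall y \near x, A y by apply: open_nbhs_nbhs.
have lc : {for (0 : R), continuous (fun t : R => t *: e + x)}.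
  by apply: cvgD; [exact: scalel_continuous|exact: cvg_cst].
have : \forall t \near (0 : R), A (t *: e + x).
  by apply: lc; rewrite scale0r add0r.
move=> /near_ball[d d0 dA].
have dA' t : t \in `]- d, d[ -> A (t *: e + x).
  by rewrite in_itv /= => /andP[t1 t2]; apply: dA; rewrite subr0 ltr_norml t1.
have D (t : R) : A (t *: e + x) -> is_derive t 1 (fun t : R => f (t *: e + x)) ('d f (t *: e + x) e).
  by move=> tA; apply: is_derive_line; exact: fd.
have [] := @derive1_at_min R (fun t : R => f (t *: e + x)) (- d) d 0.
- by rewrite -subr_ge0 opprK addr_ge0 // ltW.
- by move=> t /dA' /D[].
- by rewrite in_itv /= oppr_lt0 d0.
- by move=> t /dA'; rewrite scale0r add0r; exact: fmin.
move=> _ D0.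
have [_] : is_derive (0 : R) 1 (fun t : R => f (t *: e + x)) ('d f (0 *: e + x) e).
  by apply: D; rewrite scale0r add0r.
by rewrite D0 scale0r add0r.
Qed.

Lemma rho_tvec_linear i x u : linear (fun v : E => rho (tvec i x u) (tvec i x v)).
Proof. by move=> a v w; rewrite tvec_linear; have [rl _ _] := rho_metric x; exact: rl. Qed.

Lemma rho_tvec_linear_l i x v : linear (fun u : E => rho (tvec i x u) (tvec i x v)).
Proof.
have [_ rs _] := rho_metric x.
by move=> a u w; rewrite ![rho _ (tvec i x v)]rs; exact: rho_tvec_linear.
Qed.

(** [gradient] is an [xget] with default value 0, so its defining property rests on the existence of
    a representing vector, found by [riesz] in the chart at [x]. *)
Lemma gradientP (f : N -> R) x w : rho (gradient rho f x) w = dfun f w.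
Proof.
rewrite /gradient; move: w.
set P := [set g | _]; suff [g gP] : exists g, P g by exact: (xgetPex 0 (ex_intro _ g gP)).
set i := chart_at x; have xi : chart_dom i x := chart_atP x.
have [|a aP] := riesz (rho_tvec_linear i x) (rho_tvec_linear_l i x) _
  (linearP ('d (f \o chart_inv i) (chart i x))).
  by move=> u u0; have [_ _] := rho_metric x; apply; exact: tvec_neq0.
exists (tvec i x a) => w /=.
by rewrite -[w in LHS](tvecK _ xi) aP.
Qed.

Lemma linear_row_bounded (F : E -> R) : linear F -> exists2 C, 0 < C & forall u, `|F u| <= C * `|u|.
Proof.
move=> lF.
have [|||C C0 CP] := @linear_family_bound R n R unit (nbhs (0 : R)) _ (fun _ _ e => F e) (fun _ _ => 1).
- by apply: nearW.
- by [].
- by move=> e; exists (`|F e|); apply: nearW => _ _; rewrite mulr1.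
exists C => // u; have := nbhs_singleton CP tt u.
by rewrite mulr1.
Qed.

(* [conorm] is a [sup], which is [0] on unbounded sets: boundedness of the set
   comes from the finite dimension. *)
Lemma conorm_bound x (alpha : tangent x -> R) : scalar alpha ->
  forall v, `|alpha v| <= conorm rho alpha * tnorm rho v.
Proof.
move=> la v.
set i := chart_at x; have xi : chart_dom i x := chart_atP x.
have lF : linear (fun u : E => alpha (tvec i x u)).
  by move=> a u w; rewrite tvec_linear; exact: la.
have [C C0 CP] := linear_row_bounded lF.
have [l l0 lP] := posdef_coercive (rho_tvec_linear i x) (rho_tvec_linear_l i x)
  (fun u u0 => let: And3 _ _ p := rho_metric x in p _ (tvec_neq0 xi u0)).
have aZ a w := linear_homog a w la.
have rZ a (w : tangent x) : rho (a *: w) (a *: w) = a ^+ 2 * rho w w.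
  have [rl rs _] := rho_metric x.
  by rewrite (linear_homog _ _ (rl _)) rs (linear_homog _ _ (rl _)) mulrA.
have bd : has_sup [set `|alpha v| | v in [set v | tnorm rho v <= 1]].
  split; first by exists `|alpha 0|, 0 => //=; rewrite /tnorm -(scale0r (0 : tangent x)) rZ expr0n mul0r sqrtr0.
  (* On the unit ball of [rho], coercivity bounds the squared coordinate norm by [l^-1], and a
     number is at most 1 plus its square. *)
  exists (C * (1 + l^-1)) => _ [w /= w1 <-].
  rewrite -[w](tvecK _ xi); apply: le_trans (CP _) _; rewrite ler_pM2l //.
  have rw : rho w w <= 1.
    have rw0 := rho_ge0 rho_metric w.
    rewrite -(sqr_sqrtr rw0) expr_le1 ?sqrtr_ge0 //.
  have := lP (w i); rewrite tvecK // => H.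
  have H2 : `|w i| ^+ 2 <= l^-1.
    by rewrite -[l^-1]mul1r ler_pdivlMr // mulrC; exact: le_trans H rw.
  apply: le_trans (_ : 1 + `|w i| ^+ 2 <= _); last by rewrite lerD2l.
  exact: le_1D_sqr.
have [->|v0] := eqVneq v 0.
  have := aZ 0 0; rewrite scale0r mul0r => ->.
  by rewrite normr0 /tnorm -(scale0r (0 : tangent x)) rZ expr0n mul0r sqrtr0 mulr0.
have rv : 0 < tnorm rho v.
  by rewrite sqrtr_gt0; have [_ _] := rho_metric x; apply.
have -> : `|alpha v| = `|alpha ((tnorm rho v)^-1 *: v)| * tnorm rho v.
  by rewrite aZ normrM gtr0_norm ?invr_gt0 // mulrAC mulVf ?gt_eqF // mul1r.
rewrite ler_pM2r //; apply: ub_le_sup; first by case: bd.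
exists ((tnorm rho v)^-1 *: v) => //=.
rewrite {1}/tnorm rZ sqrtrM ?sqr_ge0 // sqrtr_sqr gtr0_norm ?invr_gt0 //.
by rewrite -/(tnorm rho v) mulVf // gt_eqF.
Qed.

End Gradient.

(** * Equilibrium and instability at a zero of the potential *)

Section Instability.
Context {R : realType} {n : nat} (N : smoothManifold R n).
Local Notation E := 'rV[R]_n.
Variables (Q mu : forall x : N, tangent x -> R) (U : N -> R)
  (rho : forall x : N, tangent x -> tangent x -> R).
Hypothesis Q_C2 : Ck_form 2 Q.
Hypothesis mu_form : one_form mu.
Hypothesis mu_C2 : Ck_form 2 mu.
Hypothesis U_C2 : Ck_fun 2 setT U.
Hypothesis U_ge0 : forall x, 0 <= U x.
Hypothesis rho_metric : riemannian_metric rho.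
Hypothesis Q_rho : forall x (v : tangent x), Q v = tnorm rho v ^+ 2 / 2.

Let mech i := mechanical_chart Q_C2 mu_form mu_C2 U_C2 rho_metric Q_rho i.

(** At zero velocity the momentum is constant in time, the kinetic and magnetic terms vanish for all
    positions, and the differential of [U] vanishes at [p], where the nonnegative [U] attains its
    minimum. *)
Lemma equilibrium_at_zero (p : N) : U p = 0 -> equilibrium (lagrangian Q mu U) p.
Proof.
move=> Up; split => //; first exact: openT.
  split=> [t _|i]; first exact: cvg_cst.
  exact: (@Ck_cst R _ _ 2 _ (chart i p)).
move=> t _ i gi e /=.
have vE (s : R) : 'D_1 (chart i \o (cst p : R -> N)) s = 0.
  exact: (@derive_cst R _ _ (chart i p) s 1).
have pO : (chart i @` chart_dom i) (chart i p) by exists p.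
have RE : 'D_e (fun xi => local_rep (lagrangian Q mu U) i xi 0) (chart i p) = 0.
  rewrite (positionE Q_C2 mu_form mu_C2 U_C2 rho_metric Q_rho 0 e pO).
  have t0 xi : tvec i (chart_inv i xi) 0 = 0.
    by have := tvec_linear i (chart_inv i xi) (-1) 0 0; rewrite scaler0 addr0 scaleN1r addNr.
  have d0 (g : E -> R) : (forall y, g y = 0) -> 'd g (chart i p) e = 0.
    move=> g0; have -> : g = cst 0 by apply/funext.
    by rewrite diff_cst.
  have z1 : 'd (fun y => local_metric rho i y 0 0) (chart i p) e = 0.
    apply: d0 => y; rewrite /local_metric t0.
    have [rl _ _] := rho_metric (chart_inv i y).
    by have := rl 0 (-1) 0 0; rewrite scaler0 addr0 mulN1r addNr.
  have z2 : 'd (local_rep mu i ^~ 0) (chart i p) e = 0.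
    apply: d0 => y.
    by have := mech_form_linear (mech i) y (-1) 0 0; rewrite scaler0 addr0 scaleN1r addNr.
  have z3 : 'd (U \o chart_inv i) (chart i p) e = 0.
    apply: (diff_at_min e (mech_open (mech i)) pO).
      by move=> y yO; exact: (mech_potential_diff (mech i)).
    by move=> y _ /=; rewrite chartK // Up.
  have aux (a b c : R) : a = 0 -> b = 0 -> c = 0 -> a / 2 + b - c = 0.
    by move=> -> -> ->; rewrite mul0r addr0 subr0.
  exact: (aux _ _ _ z1 z2 z3).
have LE : (fun s : R => 'D_e (fun u => local_rep (lagrangian Q mu U) i ((chart i \o (cst p : R -> N)) s) u)
    ('D_1 (chart i \o (cst p : R -> N)) s)) =
    cst ('D_e (fun u => local_rep (lagrangian Q mu U) i (chart i p) u) 0).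
  by apply/funext => s; rewrite vE.
suff G : is_derive t (1 : R) (fun s : R => 'D_e (fun u => local_rep (lagrangian Q mu U) i ((chart i \o (cst p : R -> N)) s) u)
    ('D_1 (chart i \o (cst p : R -> N)) s))
  ('D_e (fun xi => local_rep (lagrangian Q mu U) i xi ('D_1 (chart i \o (cst p : R -> N)) t)) (chart i p)) by exact: G.
rewrite LE vE RE; exact: is_derive_cst.
Qed.

Lemma curve_derivatives J (g : R -> N) i (t : R) : open J -> Ck_curve 2 J g ->
  J t -> chart_dom i (g t) ->
  let v := 'D_1 (chart i \o g) in
  is_derive t (1 : R) (chart i \o g) (v t) /\ is_derive t (1 : R) v ('D_1 v t).
Proof.
move=> oJ [gc gC] Jt gi v.
have oA : open (J `&` g @^-1` chart_dom i).
  by apply: open_curve_preimage => //; exact: chart_dom_open.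
have At : (J `&` g @^-1` chart_dom i) t by [].
have [cd /(_ 1)[vd _]] := gC i.
split; first by apply: derivableP; apply: diff_derivable; exact: cd.
have VE : {in J `&` g @^-1` chart_dom i, (fun s => 'd (chart i \o g) s 1) =1 v}.
  by move=> s /set_mem As; rewrite /v deriveE //; exact: cd.
have [vdt _] := is_diff_open oA At VE (differentiableP (vd t At)).
by apply: derivableP; apply: diff_derivable.
Qed.

(** The vector inside [phase g t] has a type depending on [g t], which hinders rewriting; with [x]
    and [u] free, both equations can be eliminated by substitution. *)
Lemma phaseE (g : R -> N) (t : R) x u :
  g t = x -> 'D_1 (chart (chart_at x) \o g) t = u ->
  phase g t = tb_point (tvec (chart_at x) x u).
Proof. by move=> <- <-. Qed.

Variables (p : N) (V : set N) (f : N -> R).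
Hypothesis Up : U p = 0.
Hypothesis V_nbhs : open_nbhs p V.
Hypothesis f_C3 : Ck_fun 3 V f.
Hypothesis f_regular : regular_on V f.

Let oV : open V := V_nbhs.1.
Let pV : V p := V_nbhs.2.

Lemma Ck_fun_pred k (A : set N) (g : N -> R) : Ck_fun k.+1 A g -> Ck_fun k A g.
Proof. by move=> gC i; apply: Ck_pred; exact: gC. Qed.

Lemma local_gradientP i x e : V x -> chart_dom i x ->
  local_metric rho i (chart i x) (gradient rho f x i) e = 'd (f \o chart_inv i) (chart i x) e.
Proof.
move=> Vx xi; rewrite /local_metric chartK // tvecK // gradientP //.
rewrite (dfun_chart _ oV Vx (Ck_fun_pred (Ck_fun_pred f_C3)) xi).
by rewrite tvec_coord.
Qed.

Lemma local_potential_bound i x K : chart_dom i x ->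
  `|dfun U (gradient rho f x)| <= K * U x ->
  `|'d (U \o chart_inv i) (chart i x) (gradient rho f x i)| <= K * (U \o chart_inv i) (chart i x).
Proof.
move=> xi; rewrite (dfun_chart _ openT I (Ck_fun_pred U_C2) xi) /=.
by rewrite chartK.
Qed.

Lemma local_magnetic_bound i x K v : chart_dom i x ->
  `|conorm rho (dform mu (gradient rho f x))| <= K * Num.sqrt (U x) ->
  `|'d (local_rep mu i ^~ v) (chart i x) (gradient rho f x i) -
    'd (local_rep mu i ^~ (gradient rho f x i)) (chart i x) v| <=
  K * Num.sqrt ((U \o chart_inv i) (chart i x)) * Num.sqrt (local_metric rho i (chart i x) v v).
Proof.
move=> xi cK.
set G := gradient rho f x in cK *; set m := local_rep mu i; set q := chart i x.
have dE (w : tangent x) : dform mu G w = 'd (m ^~ (w i)) q (G i) - 'd (m ^~ (G i)) q (w i).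
  by apply: (dform_chart Q_C2 mu_form mu_C2 U_C2 rho_metric Q_rho).
have qO : (chart i @` chart_dom i) q by exists x.
have FL := linear_sub
  (diff_param_linear (G i) (mech_form_linear (mech i)) (fun u => mech_form_diff (mech i) u qO))
  (linearP ('d (m ^~ (G i)) q)).
have sG : scalar (dform mu G).
  by move=> a w w'; rewrite !dE; exact: FL.
have := conorm_bound rho_metric sG (tvec i x v).
rewrite dE tvec_coord // => H; apply: le_trans H _.
rewrite /local_metric /= /q chartK // ler_wpM2r ?sqrtr_ge0 //.
exact: le_trans (ler_norm _) cK.
Qed.

Hypothesis dU_O : big_O_on V (fun x => dfun U (gradient rho f x)) U.
Hypothesis dmu_O : big_O_on V (fun x => conorm rho (dform mu (gradient rho f x)))
             (fun x => Num.sqrt (U x)).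

Lemma ascent_direction i : chart_dom i p ->
  exists u : E, 0 < 'd (f \o chart_inv i) (chart i p) u.
Proof.
move=> ip; have [v] := f_regular pV.
rewrite (dfun_chart _ oV pV (Ck_fun_pred (Ck_fun_pred f_C3)) ip) => v0.
have [v_gt0|v_lt0|v_eq0] := ltgtP 0 ('d (f \o chart_inv i) (chart i p) (v i)).
- by exists (v i).
- by exists (- v i); rewrite linearN oppr_gt0.
- by move: v0; rewrite -v_eq0 eqxx.
Qed.

(** Stability, applied to a single neighborhood [O], makes the solution global in positive time and
    confines it to one chart where all bounds hold, so no exit time has to be discussed; the growth
    of [f] contradicts this confinement. *)
Lemma unstable_at_zero : ~ lyapunov_stable (lagrangian Q mu U) p.
Proof.
move=> stable.
set i := chart_at p; have ip : chart_dom i p := chart_atP p.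
set q0 := chart i p.
pose OV := chart_image i V.
pose h := f \o chart_inv i; pose W := U \o chart_inv i.
pose r := local_metric rho i; pose m := local_rep mu i.
have oOV : open OV by exact: chart_image_openB.
have q0V : OV q0 by exists p.
have OVOm : OV `<=` chart i @` chart_dom i by move=> _ [x [xi _] <-]; exists x.
have hC : Ck 2 OV h by exact: (Ck_fun_pred f_C3 i).
have [u0 a0] := ascent_direction ip.
set alpha := 'd _ _ u0 in a0.
have u0_neq0 : u0 != 0 by apply: contraTneq a0; rewrite /alpha => ->; rewrite linear0 ltxx.
have q0O := OVOm _ q0V.
pose beta := r q0 u0 u0 / 2.
have b0 : 0 < beta by rewrite divr_gt0 // (mech_metric_pos (mech i)).
have [C C0 CP] := hessian_bound (mech i) oOV OVOm hC q0V.
have [K1 K10 K1P] := dU_O; have [K2 K20 K2P] := dmu_O.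
pose D := 2 * C + K1 + 2 * K2.
have D0 : 0 < D by rewrite !addr_gt0 // mulr_gt0.
(* The gain given by [linear_growth] for the constant [D]; it involves only data at [p] and the
   bounds, so [O] can be fixed before [e]. *)
pose delta := alpha ^+ 2 / (4 * D * beta).
have d0 : 0 < delta.
  by apply: divr_gt0; [exact: exprn_gt0|apply: mulr_gt0 => //; exact: mulr_gt0].
have [P [nP PE]] : exists P : set E, (\forall q \near q0, P q) /\
  forall q, P q -> [/\ OV q, h q - h q0 < delta &
  forall X, (forall e, r q X e = 'd h q e) ->
    forall v, `|'d (fun y => 'd h y v) q v + 'd (fun y => r y v v) q X / 2
      - 'd (fun y => r y v X) q v| <= C * r q v v].
  (* [P] is left to unification and becomes the set of points with the three properties. *)
  eexists; split; last by move=> q; exact.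
  have nV : \forall q \near q0, OV q by apply: open_nbhs_nbhs.
  have nh : \forall q \near q0, h q - h q0 < delta.
    have /cvgrPdist_lt /(_ _ d0) : {for q0, continuous h}.
      by have : Ck 0 OV h := Ck_pred (Ck_pred hC); apply.
    apply: filterS => q; rewrite distrC; exact: le_lt_trans (ler_norm _).
  have FN : Filter (nbhs q0) by exact: nbhs_filter.
  by apply: (@filterS3 _ _ FN _ _ _ _ _ nV nh CP) => q q1 q2 q3; split.
(* Only positions are constrained; energy conservation takes care of velocities. *)
pose O : set (tangent_bundle N) :=
  [set z | chart_dom i (tag z) /\ P (chart i (tag z))].
have nO : tb_nbhs (tb_point (0 : tangent p)) O.
  rewrite /tb_nbhs /=.
  have nP' : \forall y \near (q0, (0 : tangent p) i), P y.1.
    exists ([set q | P q], setT); first by split; [exact: nP|exact: filterT].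
    by move=> y [].
  apply: filterS nP' => y Py /=.
  have [[x [xi xV] xE] _ _] := PE _ Py.
  by rewrite /O /= -xE chartK // xE.
have [S nS SP] := stable O nO.
have [e [e0 eS]] : exists e : R, 0 < e /\ S (tb_point (tvec i p (e *: u0))).
  have cc : {for (0 : R), continuous (fun e : R => (q0, e *: u0))}.
    have [cd _] := is_diff_pair (is_diff_cst q0 (0 : R))
      (is_diff_scale (is_diff_id (0 : R)) (is_diff_cst u0 (0 : R))).
    exact: differentiable_continuous cd.
  have := cc; rewrite /prop_for /continuous_at scale0r => /(_ _ nS).
  move=> /near_ball[e /= e0 eP]; exists (e / 2); split; first by rewrite divr_gt0.
  have := eP (e / 2); rewrite subr0 gtr0_norm ?divr_gt0 // /q0 chartK //.
  by apply; rewrite ltr_pdivrMr // ltr_pMr // ltr1n.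
have [J0 [g0 [sol0 g00 g0v]]] := local_solution Q_C2 mu_form mu_C2 U_C2 rho_metric Q_rho (e *: u0) ip.
have [J [g [maxg J0J gg0]]] := maximal_extension sol0.
have [sol _] := maxg.
have [_ oJ0 J00 _ _] := sol0.
have g_0 : g 0 = p by rewrite gg0.
have gv : 'D_1 (chart i \o g) 0 = e *: u0.
  rewrite -g0v; apply: near_eq_derive.
  have : nbhs (0 : R) J0 by apply: open_nbhs_nbhs.
  by apply: filterS => s Js /=; rewrite gg0.
have gP (t : R) : 0 <= t -> J t /\ O (phase g t).
  by move=> t0; apply: (SP J g maxg _ t t0); rewrite (phaseE g_0 gv).
have [_ oJ _ gC EL] := sol.
pose c := chart i \o g; pose v := 'D_1 c; pose a := 'D_1 v.
have gi (t : R) : 0 <= t -> chart_dom i (g t) by move=> /gP[_ []].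
have cP (t : R) : 0 <= t -> P (c t) by move=> /gP[_ []].
have cO (t : R) : 0 <= t -> (chart i @` chart_dom i) (c t) by move=> /gi; exists (g t).
have gV (t : R) : 0 <= t -> V (g t).
  move=> t0; have [[x [xi xV] xE] _ _] := PE _ (cP t t0).
  by rewrite -(chartK (gi t t0)) -[chart i (g t)]xE chartK.
have cD (t : R) : 0 <= t -> is_derive t (1 : R) c (v t) /\ is_derive t (1 : R) v (a t).
  by move=> t0; apply: (curve_derivatives oJ gC (gP t t0).1 (gi t t0)).
have EQ (t : R) : 0 <= t -> forall w, r (c t) (a t) w = force r m W (c t) (v t) w.
  move=> t0 w; have [cDt vDt] := cD t t0.
  apply/(EL_iff_force (mech i) w (cO t t0) cDt vDt).
  have := (EL_chartP Q_C2 mu_form mu_C2 U_C2 rho_metric Q_rho (gi t t0)).1 (EL t (gP t t0).1 i (gi t t0)).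
  exact.
pose en t := r (c t) (v t) (v t) / 2 + W (c t).
have enD (t : R) : 0 <= t -> is_derive t (1 : R) en 0.
  move=> t0; have [cDt vDt] := cD t t0.
  exact: (energy_conserved (mech i) (cO t t0) cDt vDt (EQ t t0)).
(* Since [U p = 0], the initial energy is purely kinetic, hence quadratic in [e]. *)
have en0 : en 0 = e ^+ 2 * beta.
  have c0 : c 0 = q0 by rewrite /c /= g_0.
  rewrite /en c0 [v 0]gv.
  rewrite (_ : W q0 = 0); last by rewrite /W /= chartK.
  rewrite /r (linear_homog _ _ (mech_metric_linear (mech i) _ _)).
  rewrite (linear_homog e u0 (mech_metric_linear_l (mech i) q0 u0)).
  by rewrite /beta addr0 !mulrA -expr2.
have enE (t : R) : 0 <= t -> en t = e ^+ 2 * beta.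
  move=> t0; rewrite -en0; have [->//|tn0] := eqVneq t 0.
  have tp : 0 < t by rewrite lt0r tn0.
  have [|s _] := @MVT_is_derive R en (fun=> 0) 0 t tp.
    by move=> x /andP[x0 _]; exact: enD.
  by rewrite mul0r => /eqP; rewrite subr_eq0 => /eqP.
pose X t := gradient rho f (g t) i.
have XP (t : R) : 0 <= t -> forall w, r (c t) (X t) w = 'd h (c t) w.
  by move=> t0 w; exact: (local_gradientP w (gV t t0) (gi t t0)).
pose dphi t := 'd (fun y => 'd h y (v t)) (c t) (v t) + force r m W (c t) (v t) (X t).
have [||||t t0 tP] := @linear_growth R (fun t => 'd h (c t) (v t)) (h \o c) dphi e alpha beta D e0 a0 b0 D0.
- move=> t t0; have [cDt _] := cD t t0; have [ctV _ _] := PE _ (cP t t0).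
  have := is_diff_derive1 (is_diff_comp (is_derive_diff cDt) (Ck_is_diff hC ctV)).
  by rewrite /= scale1r.
- move=> t t0; have [cDt vDt] := cD t t0; have [ctV _ _] := PE _ (cP t t0).
  exact: (gradient_momentum_derive (mech i) hC ctV cDt vDt (EQ t t0) (XP t t0)).
- move=> t t0; have [ctV _ ctP] := PE _ (cP t t0).
  rewrite -(enE t t0); apply: (gradient_momentum_bound (ltW C0) (ltW K10) (ltW K20)).
  + exact: U_ge0.
  + exact: rho_ge0.
  + exact: ctP (XP t t0) _.
  + exact: (local_potential_bound (gi t t0) (K1P _ (gV t t0))).
  + exact: (local_magnetic_bound _ (gi t t0) (K2P _ (gV t t0))).
- by rewrite /c /= g_0 [v 0]gv linearZ.
(* Confinement to [P] keeps the increase of [f] below [delta] at the very time when it has reached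
   [delta]. *)
have [_ + _] := PE _ (cP t t0).
move: tP; rewrite /= /c /= g_0 -/q0 => tP; rewrite ltNge.
by rewrite tP.
Qed.

End Instability.


Theorem mainTheorem1 (R : realType) (n : nat) (N : smoothManifold R n)
  (Q : forall x : N, tangent x -> R)
  (Q_quadratic : forall x, quadratic_form (Q x))
  (Q_posdef : forall x (v : tangent x), v != 0 -> 0 < Q x v)
  (Q_C2 : Ck_form 2 Q)
  (mu : forall x : N, tangent x -> R)
  (mu_form : one_form mu) (mu_C2 : Ck_form 2 mu)
  (U : N -> R) (U_ge0 : forall x, 0 <= U x) (U_C2 : Ck_fun 2 setT U)
  (rho : forall x : N, tangent x -> tangent x -> R)
  (rho_metric : riemannian_metric rho)
  (Q_rho : forall x (v : tangent x), Q x v = tnorm rho v ^+ 2 / 2)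
  (p : N) (Up : U p = 0)
  (V : set N) (V_nbhs : open_nbhs p V)
  (f : N -> R) (f_C3 : Ck_fun 3 V f) (f_regular : regular_on V f)
  (dU_O : big_O_on V (fun x => dfun U (gradient rho f x)) U)
  (dmu_O : big_O_on V (fun x => conorm rho (dform mu (gradient rho f x)))
             (fun x => Num.sqrt (U x))) :
  lyapunov_unstable_equilibrium (fun x v => Q x v + mu x v - U x) p.
Proof.
split.
  exact: (equilibrium_at_zero Q_C2 mu_form mu_C2 U_C2 U_ge0 rho_metric Q_rho Up).
exact: (unstable_at_zero Q_C2 mu_form mu_C2 U_C2 U_ge0 rho_metric Q_rho Up
  V_nbhs f_C3 f_regular dU_O dmu_O).
Qed.
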